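(* Let $\mathcal{I}$ denote the set of Borel probability measures $p$ on $SL(2,\mathbb{R})$ with $\int \log\|\alpha\|\,dp(\alpha)<\infty$, and let $P_1(SL(2,\mathbb{R}))\subset\mathcal{I}$ be the Wasserstein space of Borel probability measures with finite first moment. Then: (1) the function $p\mapsto\lambda_+(p)$ is upper semi-continuous on $P_1(SL(2,\mathbb{R}))$ for the Wasserstein topology, but $p\mapsto\lambda_+(p)$ is not upper semi-continuous on $\mathcal{I}$ for the weak* topology; (2) the function $p\mapsto\lambda_-(p)$ is lower semi-continuous on $P_1(SL(2,\mathbb{R}))$ for the Wasserstein topology, but $p\mapsto\lambda_-(p)$ is not lower semi-continuous on $\mathcal{I}$ for the weak* topology.
   Context: Norm and metric: $\|\cdot\|$ is the operator norm on $2\times 2$ real matrices induced by the Euclidean norm, and $SL(2,\mathbb{R})$ carries the metric $d(\alpha,\beta)=\|\alpha-\beta\|$. Note that $\|\alpha\|=\|\alpha^{-1}\|\ge 1$ for $\alpha\in SL(2,\mathbb{R})$. Lyapunov exponents: Let $M=SL(2,\mathbb{R})^{\mathbb{Z}}$, let $f:M\to M$, $(\alpha_n)_n\mapsto(\alpha_{n+1})_n$ be the shift, $A:M\to SL(2,\mathbb{R})$, $A((\alpha_n)_n)=\alpha_0$, and for $n\ge1$ let $A^n((\alpha_k)_k)=\alpha_{n-1}\cdots\alpha_0$ and $A^{-n}((\alpha_k)_k)=\alpha_{-n}^{-1}\cdots\alpha_{-1}^{-1}$. For a Borel probability measure $p$ on $SL(2,\mathbb{R})$ with $\int\log\|\alpha\|\,dp(\alpha)<\infty$,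 let $\mu=p^{\mathbb{Z}}$ be the Bernoulli measure. The limits $\lambda_+(x)=\lim_n\frac1n\log\|A^n(x)\|$ and $\lambda_-(x)=\lim_n\frac1n\log\|A^{-n}(x)\|^{-1}$ exist and are constant for $\mu$-almost every $x$ (Furstenberg--Kesten and ergodicity); these constants are the Lyapunov exponents $\lambda_+(p)$ and $\lambda_-(p)$. Topologies: $P_1(SL(2,\mathbb{R}))$ is the set of Borel probability measures $p$ on $SL(2,\mathbb{R})$ with $\int d(\alpha,\mathrm{id})\,dp(\alpha)<\infty$. Its Wasserstein topology is the one metrized by $W_1(p,p')=\inf_{\pi}\int d(x,y)\,d\pi(x,y)$, the infimum being over all couplings $\pi$ of $p$ and $p'$ (measures on the product projecting to $p$ and $p'$). The weak* topology is the topology of convergence of integrals of bounded continuous functions. *)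

(* Defs.v *)
From HB Require Import structures.
From mathcomp Require Import all_boot all_order all_algebra.
From mathcomp Require Import all_classical all_reals all_analysis.
From mathcomp Require Import ring.
Import Order.TTheory GRing.Theory Num.Theory.
Import numFieldNormedType.Exports.

Set Implicit Arguments.
Unset Strict Implicit.
Unset Printing Implicit Defensive.

Local Open Scope classical_set_scope.
Local Open Scope ring_scope.

Section operator_norm.
Context {R : realType}.
Implicit Types (v w : 'cV[R]_2) (A B : 'M[R]_2).

Definition enorm v : R := Num.sqrt (\sum_i v i ord0 ^+ 2).

Definition opnorm A : R :=
  sup [set enorm (A *m v) | v in [set v : 'cV[R]_2 | enorm v <= 1]].

Lemma enorm0 : enorm 0 = 0.
Proof.
by rewrite /enorm big1 ?sqrtr0// => i _; rewrite mxE expr0n.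
Qed.

Lemma enorm_ge0 v : 0 <= enorm v. Proof. exact: sqrtr_ge0. Qed.

Lemma enormN v : enorm (- v) = enorm v.
Proof. by congr Num.sqrt; apply: eq_bigr => i _; rewrite mxE sqrrN. Qed.

Lemma enorm_sqr v : enorm v ^+ 2 = v ord0 ord0 ^+ 2 + v ord_max ord0 ^+ 2.
Proof.
rewrite /enorm sqr_sqrtr; last by apply: sumr_ge0 => i _; exact: sqr_ge0.
rewrite big_ord_recl big_ord1; congr (_ + v _ _ ^+ 2); exact: val_inj.
Qed.

Lemma enormD v w : enorm (v + w) <= enorm v + enorm w.
Proof.
rewrite -(ler_pXn2r (ltn0Sn 1)) ?nnegrE ?addr_ge0 ?enorm_ge0//.
rewrite sqrrD !enorm_sqr !mxE.
set a := v _ _; set b := v _ _; set c := w _ _; set d := w _ _.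
have abcd : a * c + b * d <= enorm v * enorm w.
  apply: (le_trans (ler_norm _)).
  rewrite -(ler_pXn2r (ltn0Sn 1)) ?nnegrE ?mulr_ge0 ?enorm_ge0 ?normr_ge0//.
  rewrite real_normK ?num_real// exprMn !enorm_sqr -/a -/b -/c -/d.
  rewrite -subr_ge0 [leRHS](_ : _ = (a * d - b * c) ^+ 2) ?sqr_ge0//.
  by ring.
rewrite (_ : _ + _ = a ^+ 2 + b ^+ 2 + (a * c + b * d) *+ 2
                     + (c ^+ 2 + d ^+ 2)); last by ring.
by rewrite lerD2r lerD2l lerMn2r abcd orbT.
Qed.

Let img A := [set enorm (A *m v) | v in [set v : 'cV[R]_2 | enorm v <= 1]].

Lemma opnorm_has_sup A : has_sup (img A).
Proof.
split; first by exists (enorm (A *m 0)), 0; rewrite //= enorm0 ler01.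
exists (\sum_i \sum_j `|A i j|) => _ [v /= v1 <-].
have coord i : `|v i ord0| <= 1.
  apply: le_trans v1; rewrite -sqrtr_sqr ler_wsqrtr//.
  rewrite (bigD1 i)//= lerDl; apply: sumr_ge0 => k _; exact: sqr_ge0.
have S0 (w : 'cV[R]_2) : 0 <= \sum_i `|w i ord0| by apply: sumr_ge0.
have enorm_le (w : 'cV[R]_2) : enorm w <= \sum_i `|w i ord0|.
  rewrite -(ler_pXn2r (ltn0Sn 1)) ?nnegrE ?enorm_ge0//.
  rewrite enorm_sqr big_ord_recl big_ord1.
  rewrite (_ : lift _ _ = ord_max); last exact: val_inj.
  by rewrite sqrrD !real_normK ?num_real// lerD2r lerDl mulrn_wge0// mulr_ge0.
apply: (le_trans (enorm_le _)); apply: ler_sum => i _; rewrite mxE.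
apply: (le_trans (ler_norm_sum _ _ _)); apply: ler_sum => j _.
by rewrite normrM ler_piMr// coord.
Qed.

Lemma opnorm_ub A v : enorm v <= 1 -> enorm (A *m v) <= opnorm A.
Proof.
by move=> v1; apply: ub_le_sup; [case: (opnorm_has_sup A)|exists v].
Qed.

Lemma opnorm_le A c :
  (forall v, enorm v <= 1 -> enorm (A *m v) <= c) -> opnorm A <= c.
Proof.
move=> Ac; apply: ge_sup; first by case: (opnorm_has_sup A).
by move=> _ [v /= v1 <-]; exact: Ac.
Qed.

Lemma opnorm0 : opnorm 0 = 0.
Proof.
apply/eqP; rewrite eq_le; apply/andP; split.
  by apply: opnorm_le => v _; rewrite mul0mx enorm0.
by have := @opnorm_ub 0 0; rewrite mul0mx enorm0; apply; exact: ler01.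
Qed.

Lemma opnormN A : opnorm (- A) = opnorm A.
Proof.
by rewrite /opnorm; congr sup; apply/seteqP; split => _ [v v1 <-]; exists v;
  rewrite // mulNmx enormN.
Qed.

Lemma opnormD A B : opnorm (A + B) <= opnorm A + opnorm B.
Proof.
apply: opnorm_le => v v1; rewrite mulmxDl (le_trans (enormD _ _))//.
by rewrite lerD// opnorm_ub.
Qed.

Lemma opnorm_eq0 A : opnorm A = 0 -> A = 0.
Proof.
move=> A0; apply/matrixP => i j; rewrite mxE.
have e1 : enorm (delta_mx j ord0 : 'cV[R]_2) <= 1.
  rewrite /enorm (bigD1 j)//= mxE !eqxx expr1n big1 ?addr0 ?sqrtr1// => k kj.
  by rewrite mxE (negbTE kj) expr0n.
have : enorm (col j A) = 0.
  by apply/eqP; rewrite eq_le enorm_ge0 andbT colE -A0 opnorm_ub.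
move=> /eqP; rewrite /enorm sqrtr_eq0 => le0.
have : \sum_k col j A k ord0 ^+ 2 == 0.
  by rewrite eq_le le0 sumr_ge0// => k _; exact: sqr_ge0.
rewrite psumr_eq0 => [/allP/(_ i (mem_index_enum _))|k _]; last exact: sqr_ge0.
by rewrite /= mxE sqrf_eq0 => /eqP.
Qed.

End operator_norm.

Section SL2.
Context (R : realType).

Record SL2 := mkSL2 { SL2mx :> 'M[R]_2 ; _ : \det SL2mx == 1 }.

HB.instance Definition _ := [isSub for SL2mx].
HB.instance Definition _ := [Choice of SL2 by <:].

Definition SL2one : SL2 := @mkSL2 1%:M (introT eqP (det1 _ _)).

HB.instance Definition _ := isPointed.Build SL2 SL2one.

Definition SL2dist (a b : SL2) : R := opnorm (SL2mx a - SL2mx b).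

Lemma SL2distxx a : SL2dist a a = 0.
Proof. by rewrite /SL2dist subrr opnorm0. Qed.

Lemma SL2dist_eq0 a b : SL2dist a b = 0 -> a = b.
Proof. by move=> /opnorm_eq0/subr0_eq/val_inj. Qed.

Lemma SL2dist_sym a b : SL2dist a b = SL2dist b a.
Proof. by rewrite /SL2dist -opnormN opprB. Qed.

Lemma SL2dist_triangle b a c : SL2dist a c <= SL2dist a b + SL2dist b c.
Proof.
rewrite /SL2dist; apply: le_trans (opnormD _ _).
by rewrite addrA subrK.
Qed.

HB.instance Definition _ := isMetric.Build R SL2
  SL2distxx SL2dist_eq0 SL2dist_sym SL2dist_triangle.

HB.instance Definition _ :=
  Measurable.copy SL2 (g_sigma_algebraType (@open SL2)).

End SL2.

Section bernoulli.
Context (R : realType).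

Definition cylinders : set (set (int -> SL2 R)) :=
  [set [set x | E (x n)] | n in [set: int] & E in @measurable _ (SL2 R)].

(* SL(2,R)^Z with its product sigma-algebra, which is also the Borel
   sigma-algebra of the product topology as SL(2,R) is second countable. *)
Definition SL2Z : Type := g_sigma_algebraType cylinders.

HB.instance Definition _ := Measurable.on SL2Z.

Definition is_bernoulli (p : probability (SL2 R) R)
    (mu : probability SL2Z R) : Prop :=
  forall (s : seq int) (E : int -> set (SL2 R)),
    uniq s -> (forall n, measurable (E n)) ->
    mu [set x | forall n, n \in s -> E n (x n)] = (\prod_(n <- s) p (E n))%E.

(* The product measure p^Z: it exists (Kolmogorov extension) and is unique,
   since the sets in is_bernoulli form a generating pi-system. *)
Definition bernoulli_measure (p : probability (SL2 R) R) :
  probability SL2Z R := get [set mu | is_bernoulli p mu].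

(* cocycle x n is A^n(x) = x_{n-1} ... x_0 and
   cocycleV x n is A^{-n}(x) = x_{-n}^-1 ... x_{-1}^-1. *)
Fixpoint cocycle (x : int -> SL2 R) (n : nat) : 'M[R]_2 :=
  if n is k.+1 then (x k%:Z : 'M[R]_2) *m cocycle x k else 1%:M.

Fixpoint cocycleV (x : int -> SL2 R) (n : nat) : 'M[R]_2 :=
  if n is k.+1 then invmx (x (- (k.+1)%:Z)) *m cocycleV x k else 1%:M.

(* For p with log-integrable norm the set below is a singleton, by the
   Furstenberg-Kesten theorem and ergodicity of p^Z; get returns an arbitrary
   value for the other p. *)
Definition lyap_plus (p : probability (SL2 R) R) : R :=
  get [set l : R | {ae bernoulli_measure p, forall x : SL2Z,
    (fun n => n%:R^-1 * ln (opnorm (cocycle x n))) @ \oo --> l}].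

Definition lyap_minus (p : probability (SL2 R) R) : R :=
  get [set l : R | {ae bernoulli_measure p, forall x : SL2Z,
    (fun n => n%:R^-1 * ln (opnorm (cocycleV x n))^-1) @ \oo --> l}].

End bernoulli.

Section spaces_of_measures.
Context (R : realType).
Local Open Scope ereal_scope.

Definition log_integrable : set (probability (SL2 R) R) :=
  [set p | \int[p]_(a in [set: SL2 R]) (ln (opnorm a))%:E < +oo].

Definition finite_first_moment : set (probability (SL2 R) R) :=
  [set p | \int[p]_(a in [set: SL2 R]) (mdist a (SL2one R))%:E < +oo].

Definition couplings (p q : probability (SL2 R) R) :
    set (probability (SL2 R * SL2 R)%type R) :=
  [set pi | forall E, measurable E ->
    pi (E `*` setT) = p E /\ pi (setT `*` E) = q E].

Definition W1 (p q : probability (SL2 R) R) : \bar R :=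
  ereal_inf [set \int[pi]_(z in [set: SL2 R * SL2 R]) (mdist z.1 z.2)%:E | pi in couplings p q].

Definition wasserstein_space : Type := set_type finite_first_moment.

HB.instance Definition _ := Choice.on wasserstein_space.

Implicit Types p q : wasserstein_space.

(* The open sets of the metric W1. Stated through balls, so that the triangle
   inequality for W1 is not needed to define the topology. *)
Definition W1_open : set (set wasserstein_space) :=
  [set U | forall p, U p ->
    exists2 e : R, (0 < e)%R & forall q, W1 (sval p) (sval q) < e%:E -> U q].

Lemma W1_openT : W1_open setT.
Proof. by move=> p _; exists 1%R. Qed.

Lemma W1_openI : setI_closed W1_open.
Proof.
move=> U V oU oV p [/oU[e e0 eU] /oV[e' e'0 e'V]].
exists (Num.min e e'); first by rewrite lt_min e0.
move=> q pq; split.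
  by apply/eU/(lt_le_trans pq); rewrite lee_fin ge_min lexx.
by apply/e'V/(lt_le_trans pq); rewrite lee_fin ge_min lexx orbT.
Qed.

Lemma W1_open_bigcup (I : Type) (U : I -> set wasserstein_space) :
  (forall i, W1_open (U i)) -> W1_open (\bigcup_i U i).
Proof.
move=> oU p [i _ /oU[e e0 eU]]; exists e => // q /eU Uq; by exists i.
Qed.

HB.instance Definition _ := isOpenTopological.Build wasserstein_space
  W1_openT W1_openI W1_open_bigcup.

Definition bounded_continuous : set (SL2 R -> R) :=
  [set phi | continuous phi /\ exists M : R, forall a, (`|phi a| <= M)%R].

Definition integrals (p : set_type log_integrable) :
    prod_topology (fun _ : set_type bounded_continuous => R : topologicalType) :=
  fun phi => (\int[sval p]_a (sval phi a))%R.

(* weak* topology: the coarsest one making all the maps p |-> \int phi dp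
   continuous *)
Definition weak_star_space : Type := initial_topology integrals.

HB.instance Definition _ := Topological.on weak_star_space.

End spaces_of_measures.

Section semicontinuity.
Context {X : topologicalType} {R : numFieldType}.
Local Open Scope ereal_scope.

(* dual to the library's lower_semicontinuous *)
Definition upper_semicontinuous (f : X -> \bar R) := forall x a, f x < a%:E ->
  exists2 V, nbhs x V & forall y, V y -> f y < a%:E.

End semicontinuity.

(* Main.v *)
(** Write [L f b] for the integral of [f (a b)] in [p(da)] and [l = ln ||.||].
    For log-integrable [p] the i.i.d. products satisfy a.e.
    [ln ||A^n|| / n --> inf_n (L^n l)(1) / n] (Furstenberg-Kesten), proved here by
    Steele's covering argument: as [||a^-1|| = ||a||] on [SL(2,R)], the limsup and
    liminf are exactly shift invariant, so the zero-one law makes them constant.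
    Hence [lyap_plus p] is this infimum, and [lyap_minus p] is its opposite, since
    left and right multiplication operators commute.

    If a coupling of [p] and [q] has cost [delta <= 1], then [(L_q^n l)(1) -
    (L_p^n l)(1) <= delta C_n] with [C_n] depending only on [n] and the first
    moment of [p]; an infimum of such functions is upper semicontinuous.

    For the weak* topology, [(1 - 1/k) dirac_1 + (1/k) dirac_(diag(e^k, e^-k))]
    tends to [dirac_1], of exponent [0], but each of these measures has exponent
    [1]. *)

(* Both [bernoulli_measure] and the exponents are defined by [get]: nothing is known about them
   until p^Z is constructed and the a.e. limits are shown to exist. This is why product measures and
   an ergodic theorem precede any semicontinuity.

   The ergodic theory takes place on one-sided sequences. The coordinates 0, 1, 2, ... and the
   coordinates -1, -2, ... are both i.i.d., the latter multiplied in the opposite order, so one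
   theorem on random walks in an abstract monoid serves both exponents.

   The covering argument yields only lower bounds. Upper bounds come from applying it to the
   negatives of block sums, so no separate additive ergodic theorem is involved.

   The Wasserstein estimate is uniform in [q] because a coupling of cost at most 1 bounds the first
   moment of [q] by that of [p] plus 1. The law is exchanged one factor at a time, and each exchange
   integrates a Lipschitz function, the kind of function that W1 controls. Weak* convergence tests
   only bounded functions, whereas [ln ||.||] is unbounded: small masses may escape to infinity with
   a fixed contribution to its integral. *)
Require Import Defs.
From HB Require Import structures.
From mathcomp Require Import all_boot all_order all_algebra.
From mathcomp Require Import all_classical all_reals all_analysis.
From mathcomp Require Import measurable_realfun.
From mathcomp Require Import ring lra.
Import Order.TTheory GRing.Theory Num.Theory.
Import numFieldNormedType.Exports.

Set Implicit Arguments.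
Unset Strict Implicit.
Unset Printing Implicit Defensive.

Local Open Scope classical_set_scope.
Local Open Scope ring_scope.
Local Open Scope ereal_scope.

(** * Sequence spaces *)

Section sequence_space.
Context d (X : measurableType d).

Definition seq_cylinders : set (set (nat -> X)) :=
  [set [set x | E (x n)] | n in [set: nat] & E in @measurable _ X].

Definition seqT : Type := g_sigma_algebraType seq_cylinders.

HB.instance Definition _ := Measurable.on seqT.

Definition scons (a : X) (x : seqT) : seqT := fun n => if n is k.+1 then x k else a.

Definition sshift (x : seqT) : seqT := fun n => x n.+1.

Lemma scons_sshift (x : seqT) : scons (x 0%N) (sshift x) = x.
Proof. by apply/funext => -[]. Qed.

Lemma measurable_coord n : measurable_fun [set: seqT] (fun x : seqT => x n).
Proof.
move=> _ E mE; rewrite setTI; apply: sub_sigma_algebra.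
by exists n => //; exists E.
Qed.

Lemma measurable_seqT d' (T : measurableType d') (f : T -> seqT) :
  (forall n, measurable_fun [set: T] (fun t => f t n)) ->
  measurable_fun [set: T] f.
Proof.
move=> mf; apply: (@measurability _ _ _ _ setT f seq_cylinders) => //.
move=> _ [_ [n _ [E mE <-]] <-]; exact: mf.
Qed.

Lemma measurable_sshift : measurable_fun [set: seqT] sshift.
Proof. by apply: measurable_seqT => n; exact: measurable_coord. Qed.

Lemma measurable_scons_pair :
  measurable_fun [set: X * seqT] (fun z => scons z.1 z.2).
Proof.
apply: measurable_seqT => -[|n] /=; first exact: measurable_fst.
exact: measurableT_comp (measurable_coord n) measurable_snd.
Qed.

Lemma measurable_scons a : measurable_fun [set: seqT] (scons a).
Proof.
apply: measurable_seqT => -[|n] /=; first exact: measurable_cst.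
exact: measurable_coord.
Qed.

End sequence_space.

(** * Image measures and products of two probabilities *)

Section pushforward_measure.
Context d1 d2 (T1 : measurableType d1) (T2 : measurableType d2) (R : realType).
Variables (m : {measure set T1 -> \bar R}) (f : T1 -> T2).
Hypothesis mf : measurable_fun [set: T1] f.

Definition pushm : {measure set T2 -> \bar R} :=
  measure_function_pushforward__canonical__measure_function_Measure m mf.

Lemma pushmE A : pushm A = m (f @^-1` A). Proof. by []. Qed.

End pushforward_measure.

Section pushforward_probability.
Context d1 d2 (T1 : measurableType d1) (T2 : measurableType d2) (R : realType).
Variables (P : probability T1 R) (f : T1 -> T2).
Hypothesis mf : measurable_fun [set: T1] f.

Let mfunf : {mfun T1 >-> T2} :=
  HB.pack_for {mfun T1 >-> T2} f (isMeasurableFun.Build _ _ _ _ f mf).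

Definition pushp : probability T2 R := distribution P mfunf.

Lemma pushpE A : pushp A = P (f @^-1` A). Proof. by []. Qed.

Lemma ge0_integral_pushp (g : T2 -> \bar R) :
  measurable_fun [set: T2] g -> (forall y, 0 <= g y) ->
  \int[pushp]_y g y = \int[P]_x g (f x).
Proof.
move=> mg g0.
rewrite (@ge0_integral_pushforward _ _ _ _ _ f mf P [set: T2] g)//.
Qed.

Lemma ae_pushp (Q : T2 -> Prop) :
  {ae pushp, forall y, Q y} -> {ae P, forall x, Q (f x)}.
Proof.
move=> [A [mA A0 QA]]; exists (f @^-1` A); split => //.
  by rewrite -[X in measurable X]setTI; exact: mf.
by move=> x; exact: QA.
Qed.

End pushforward_probability.

Section product_probability.
Context d1 d2 (T1 : measurableType d1) (T2 : measurableType d2) (R : realType).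
Variables (P : probability T1 R) (Q : probability T2 R).

Let prod_setT : (P \x Q) [set: T1 * T2] = 1.
Proof.
rewrite -setXTT product_measure1E//.
by rewrite -[RHS]mule1; congr (_ * _); exact: probability_setT.
Qed.

HB.instance Definition _ :=
  Measure_isProbability.Build _ _ _ (P \x Q) prod_setT.

Definition prodp : probability (T1 * T2)%type R := P \x Q.

End product_probability.

(** * Existence of product measures *)

Section finite_products.
Context d (X : measurableType d) (R : realType) (p : probability X R).

(** One implication is enough, as [x] and [y] can be exchanged. *)
Definition depends (N : nat) (A : set (seqT X)) :=
  forall x y : seqT X, (forall n, (n < N)%N -> x n = y n) -> A x -> A y.

Lemma dependsW N M A : (N <= M)%N -> depends N A -> depends M A.
Proof. by move=> NM dA x y xy; apply: dA => n nN; exact/xy/(leq_trans nN). Qed.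

Lemma dependsC N A : depends N A -> depends N (~` A).
Proof. by move=> dA x y xy nAx Ay; apply: nAx; apply: dA Ay => n /xy. Qed.

Lemma dependsU N A B : depends N A -> depends N B -> depends N (A `|` B).
Proof. by move=> dA dB x y xy [Ax|Bx]; [left; exact: dA Ax|right; exact: dB Bx]. Qed.

Definition ssection (a : X) (A : set (seqT X)) : set (seqT X) := scons a @^-1` A.

Lemma depends_ssection N a A : depends N.+1 A -> depends N (ssection a A).
Proof. by move=> dA x y xy; apply: dA => -[|n] //=; rewrite ltnS => /xy. Qed.

Lemma measurable_ssection a A : measurable A -> measurable (ssection a A).
Proof.
by move=> mA; rewrite -[X in measurable X]setTI; exact: measurable_scons.
Qed.

(* The law of [(x_0, .., x_{N-1}, point, point, ..)] for i.i.d. [x_i]. *)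
Fixpoint nu (N : nat) : probability (seqT X) R :=
  if N is M.+1 then pushp (prodp p (nu M)) (@measurable_scons_pair _ X)
  else dirac (point : seqT X).

Lemma nuSE N A : nu N.+1 A = \int[p]_a nu N (ssection a A).
Proof.
change (nu N.+1 A) with ((p \x nu N) ((fun z : X * seqT X => scons z.1 z.2) @^-1` A)).
apply: eq_integral => a _ /=.
by congr (nu N _); apply/seteqP; split => x; rewrite /xsection /= ?inE.
Qed.

Lemma measurable_nu_ssection N A : measurable A ->
  measurable_fun [set: X] (fun a => nu N (ssection a A)).
Proof.
move=> mA.
have mB : measurable ((fun z : X * seqT X => scons z.1 z.2) @^-1` A).
  by rewrite -[X in measurable X]setTI; exact: measurable_scons_pair.
have := @measurable_fun_xsection _ _ _ _ R (nu N) _ mB.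
congr measurable_fun; apply/funext => a /=.
by congr (nu N _); apply/seteqP; split => x; rewrite /xsection /= ?inE.
Qed.

(** Consistency of the finite-dimensional laws. Sectioning at the first coordinate lowers [N] and
    [M] together; a set that depends on no coordinate is empty or full, and all probabilities agree
    on it. *)
Lemma nu_depends N M A : (N <= M)%N -> measurable A -> depends N A ->
  nu M A = nu N A.
Proof.
elim: N M A => [|N IH] M A NM mA dA.
  have [[x Ax]|A0] := pselect (A !=set0).
    have -> : A = setT by apply/seteqP; split => // y _; exact: dA Ax.
    by rewrite !probability_setT.
  have -> : A = set0 by apply/seteqP; split => // y Ay; apply: A0; exists y.
  by rewrite !measure0.
case: M NM => // M; rewrite ltnS => NM; rewrite !nuSE.
apply: eq_integral => a _; apply: IH => //; first exact: measurable_ssection.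
exact: depends_ssection.
Qed.

End finite_products.

Section cylinder_algebra.
Context d (X : measurableType d).

(** A second copy of the sequence space: its measurable sets are the algebra of cylinders, while
    [seqT] carries the generated sigma-algebra. *)
Definition cylT : Type := nat -> X.

HB.instance Definition _ := Pointed.on cylT.

Definition is_cyl (A : set cylT) :=
  @measurable _ (seqT X) A /\ exists N, depends N A.

Let is_cyl0 : is_cyl set0.
Proof. by split; [exact: measurable0|exists 0%N => x y _]. Qed.

Let is_cylU : setU_closed is_cyl.
Proof.
move=> A B [mA [N dA]] [mB [M dB]]; split; first exact: (@measurableU _ (seqT X)).
exists (maxn N M); apply: dependsU.
  exact: dependsW (leq_maxl _ _) dA.
exact: dependsW (leq_maxr _ _) dB.
Qed.

Let is_cylC : setC_closed is_cyl.
Proof.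
move=> A [mA [N dA]]; split; first exact: (@measurableC _ (seqT X)).
by exists N; exact: dependsC.
Qed.

HB.instance Definition _ := isAlgebraOfSets.Build default_measure_display cylT
  is_cyl0 is_cylU is_cylC.

Lemma cylTE (A : set cylT) : measurable A = is_cyl A. Proof. by []. Qed.

End cylinder_algebra.

Section kolmogorov_extension.
Context d (X : measurableType d) (R : realType) (p : probability X R).

(** On a cylinder the sequence is eventually constant. The limit gives a function on all sets
    without choosing, for each cylinder, a number of coordinates. *)
Definition cylm (A : set (cylT X)) : \bar R := limn (fun N => nu p N A).

Lemma cylmE N (A : set (seqT X)) : measurable A -> depends N A ->
  cylm A = nu p N A.
Proof.
move=> mA dA; apply: lim_near_cst => //.
by exists N => // M /= NM; exact: nu_depends.
Qed.

Lemma cylm_ge0 A : 0 <= cylm A.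
Proof.
rewrite /cylm; have [c|/dvgP ->//] := pselect (cvgn (fun N => nu p N A)).
by apply: lime_ge => //; apply: nearW => N; exact: measure_ge0.
Qed.

Lemma cylm_ssection A : is_cyl A -> cylm A = \int[p]_a cylm (ssection a A).
Proof.
move=> [mA [N dA]]; rewrite (@cylmE N.+1)//; last first.
  exact: dependsW dA.
rewrite nuSE; apply: eq_integral => a _; rewrite (@cylmE N)//.
  exact: measurable_ssection.
by apply: depends_ssection; exact: dependsW dA.
Qed.

Lemma is_cyl_ssection a A : is_cyl A -> is_cyl (ssection a A : set (cylT X)).
Proof.
move=> [mA [N dA]]; split; first exact: measurable_ssection.
by exists N; apply: depends_ssection; exact: dependsW dA.
Qed.

Lemma cylm_le1 A : is_cyl A -> cylm A <= 1.
Proof. by move=> [mA [N dA]]; rewrite (cylmE mA dA); exact: probability_le1. Qed.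

Lemma measurable_cylm_ssection A : is_cyl A ->
  measurable_fun [set: X] (fun a => cylm (ssection a A)).
Proof.
move=> [mA [N dA]].
have := measurable_nu_ssection p N mA; congr measurable_fun.
apply/funext => a; rewrite (@cylmE N)//; first exact: measurable_ssection.
by apply: depends_ssection; exact: dependsW dA.
Qed.

(** By contraposition: if the sections at every [a] had vanishing measure, dominated convergence
    with the bound 1 would make the integrals over [a], which are the measures of the [C k], vanish
    too. *)
Lemma cylm_ssection_pos (C : nat -> set (cylT X)) : (forall k, is_cyl (C k)) ->
  ~ (cylm (C k) @[k --> \oo] --> 0) ->
  exists a, ~ (cylm (ssection a (C k)) @[k --> \oo] --> 0).
Proof.
move=> cC; apply: contra_notP => /forallNP H.
have {}H a : cylm (ssection a (C k)) @[k --> \oo] --> 0 by apply: contrapT; exact: H.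
under eq_fun do rewrite cylm_ssection//.
have [] // := @dominated_convergence _ _ _ p _ measurableT
    (fun k a => cylm (ssection a (C k))) (cst 0) (EFin \o cst 1%R).
- by move=> k; exact: measurable_cylm_ssection.
- by apply: aeW => a _; exact: H.
- exact: finite_measure_integrable_cst.
- apply: aeW => a k _ /=; rewrite gee0_abs; last exact: cylm_ge0.
  exact/cylm_le1/is_cyl_ssection.
by move=> _ _; rewrite integral0.
Qed.

(** Bundles a sequence of cylinders with the nonvanishing of its measures, the invariant under which
    the choice of a section point can be iterated. *)
Let st := {C : nat -> set (cylT X) |
  (forall k, is_cyl (C k)) /\ ~ (cylm (C k) @[k --> \oo] --> 0)}.

Let st_step (s : st) : {a : X & {t : st |
  forall k, sval t k = ssection a (sval s k)}}.
Proof.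
case: s => C [cC nC]; have [a na] := cid (cylm_ssection_pos cC nC).
exists a; unshelve eexists.
  exists (fun k => ssection a (C k)); split => // k.
  exact: is_cyl_ssection.
by [].
Qed.

(* If the measures of a decreasing sequence of cylinders do not vanish, neither
   do those of the sections at some point [a]; iterating the choice of [a]
   builds a point of the intersection. *)
Lemma cylm_cvg0 (C : nat -> set (cylT X)) : (forall k, is_cyl (C k)) ->
  nonincreasing_seq C -> \bigcap_k C k = set0 -> cylm (C k) @[k --> \oo] --> 0.
Proof.
move=> cC ndC C0; apply: contrapT => nC.
pose s0 : st := exist _ C (conj cC nC).
pose s n : st := iter n (fun t => sval (projT2 (st_step t))) s0.
pose x : seqT X := fun n => projT1 (st_step (s n)).
have sE n k : sval (s n.+1) k = ssection (x n) (sval (s n) k).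
  exact: (svalP (projT2 (st_step (s n))) k).
have xC n k : C k x <-> sval (s n) k (iter n (@sshift _ X) x).
  elim: n => [//|n IH]; rewrite IH sE /ssection /preimage/=.
  suff -> : scons (x n) (sshift (iter n (@sshift _ X) x)) =
            iter n (@sshift _ X) x by [].
  rewrite -[RHS]scons_sshift; congr scons.
  have H m j : iter m (@sshift _ X) x j = x (m + j)%N.
    elim: m j => // m IHm j.
    by rewrite -[LHS]/(iter m (@sshift _ X) x j.+1) IHm addnS.
  by rewrite H addn0.
suff : (\bigcap_k C k) x by rewrite C0.
move=> k _; have [mC [N dC]] := cC k.
have [_] := svalP (s N); apply: contra_notP => nCx.
(* After [N] sections nothing is left to depend on, so the section of [C k] is empty or full. It is
   empty if [x] is outside [C k]; by monotonicity all later sections are empty, against the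
   invariant of [st]. *)
have dN : depends 0 (sval (s N) k).
  suff H n : (n <= N)%N -> depends (N - n) (sval (s n) k).
    by rewrite -(subnn N); exact: H.
  elim: n => [|n IH] nN; first by rewrite subn0.
  by rewrite sE; apply: depends_ssection; rewrite subnSK//; exact/IH/ltnW.
have sN0 : sval (s N) k = set0.
  apply/seteqP; split => // y Cy; apply: nCx; apply/(xC N).
  exact: dN Cy.
have sm0 j : (k <= j)%N -> sval (s N) j = set0.
  move=> kj; apply/seteqP; split => // y; rewrite -sN0.
  elim: N {mC dC dN sN0} y => [|n IH] y; first by have /subsetPset := ndC _ _ kj; apply.
  by rewrite !sE; exact: IH.
apply: cvg_near_cst; exists k => // j /= kj.
by rewrite (sm0 _ kj) (@cylmE 0 set0)// measure0.
Qed.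

End kolmogorov_extension.

Section cylinder_measure.
Context d (X : measurableType d) (R : realType) (p : probability X R).

Let cylm0 : cylm p set0 = 0.
Proof. by rewrite (@cylmE _ _ _ _ 0 set0)// measure0. Qed.

Let is_cyl_bigsetU (F : nat -> set (cylT X)) n : (forall i, is_cyl (F i)) ->
  is_cyl (\big[setU/set0]_(i < n) F i).
Proof.
by move=> cF; rewrite -cylTE; apply: bigsetU_measurable => i _; exact: cF.
Qed.

Let cylm_depends (A : set (cylT X)) : is_cyl A ->
  exists N, forall M, (N <= M)%N -> cylm p A = nu p M A.
Proof.
move=> [mA [N dA]]; exists N => M NM; apply: cylmE => //.
exact: dependsW dA.
Qed.

Let cylmD (A B : set (cylT X)) : is_cyl A -> is_cyl B -> A `&` B = set0 ->
  cylm p (A `|` B) = cylm p A + cylm p B.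
Proof.
move=> cA cB AB.
have cAB : is_cyl (A `|` B) by rewrite -cylTE; exact: measurableU.
have [N hN] := cylm_depends cA; have [M hM] := cylm_depends cB.
have [K hK] := cylm_depends cAB.
rewrite (hN (maxn N (maxn M K))) ?leq_maxl//.
rewrite (hM (maxn N (maxn M K))); last by rewrite 2!leq_max leqnn orbT.
rewrite (hK (maxn N (maxn M K))); last by rewrite 2!leq_max leqnn !orbT.
by rewrite measureU//; [case: cA|case: cB].
Qed.

Let cylm_bigsetU (F : nat -> set (cylT X)) n : (forall i, is_cyl (F i)) ->
  trivIset setT F ->
  cylm p (\big[setU/set0]_(i < n) F i) = \sum_(0 <= i < n) cylm p (F i).
Proof.
move=> cF tF; elim: n => [|n IH]; first by rewrite big_ord0 big_geq// cylm0.
rewrite big_ord_recr big_nat_recr//= cylmD// ?IH//; first exact: is_cyl_bigsetU.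
rewrite -bigcup_mkord -subset0 => x [[/= m + Fmx] Fnx].
by rewrite (tF m n) ?ltnn//=; exists x.
Qed.

(** Finite additivity reduces the claim to continuity at the empty set, applied to the remainders
    [C n] of the union. *)
Let cylm_sigma_additive : semi_sigma_additive (cylm p : set (cylT X) -> \bar R).
Proof.
move=> F mF tF mUF.
have cF i : is_cyl (F i) by rewrite -cylTE.
have cUF : is_cyl (\bigcup_n F n) by rewrite -cylTE.
pose C n := (\bigcup_n F n) `\` \big[setU/set0]_(i < n) F i.
have cC n : is_cyl (C n).
  by rewrite -cylTE; apply: measurableD => //; exact: is_cyl_bigsetU.
have C0 : cylm p (C n) @[n --> \oo] --> 0.
  apply: cylm_cvg0 => //.
    move=> m n mn; apply/subsetPset => x [Ux nx]; split => // xm; apply: nx.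
    move: xm; rewrite -!bigcup_mkord => -[i /= im Fi].
    by exists i => //=; exact: leq_trans mn.
  rewrite -subset0 => x CUx; have [[i _ Fi] _] := CUx 0%N I.
  have [_] := CUx i.+1 I; apply; rewrite -bigcup_mkord; exists i => //=.
have fUF : cylm p (\bigcup_n F n) \is a fin_num.
  by rewrite ge0_fin_numE ?cylm_ge0// (le_lt_trans (cylm_le1 p cUF))// ltry.
have E n : cylm p (\bigcup_n F n) - cylm p (C n) = \sum_(0 <= i < n) cylm p (F i).
  have fC : cylm p (C n) \is a fin_num.
    by rewrite ge0_fin_numE ?cylm_ge0// (le_lt_trans (cylm_le1 p (cC n)))// ltry.
  rewrite -cylm_bigsetU// [in X in X - _](_ : \bigcup_n F n =
      \big[setU/set0]_(i < n) F i `|` C n).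
    by rewrite cylmD ?addeK//; [exact: is_cyl_bigsetU|exact: setDIK].
  rewrite /C setDUK//= -bigcup_mkord => x [i _ Fi].
  by exists i.
have : cylm p (\bigcup_n F n) - cylm p (C n) @[n --> \oo] -->
    cylm p (\bigcup_n F n) - 0.
  by apply: cvgeB => //; [rewrite fin_num_adde_defr|exact: cvg_cst].
by rewrite sube0; apply: cvg_trans; under eq_fun do rewrite -E.
Qed.

HB.instance Definition _ := isMeasure.Build default_measure_display
  (cylT X) R (cylm p) cylm0 (@cylm_ge0 _ _ _ p) cylm_sigma_additive.

Let cylI := g_sigma_algebraType (@measurable _ (cylT X)).

Let ext : set cylI -> \bar R := measure_extension (cylm p).

HB.instance Definition _ := Measure.on ext.

Let ext_setT : ext setT = 1.
Proof.
rewrite /ext/= /measure_extension measurable_mu_extE//.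
by rewrite /= (@cylmE _ _ _ _ 0 setT)// probability_setT.
Qed.

HB.instance Definition _ := Measure_isProbability.Build _ _ _ ext ext_setT.

(** Carries the extension from the sigma-algebra generated by the algebra of cylinders to the
    product sigma-algebra of [seqT]. *)
Let measurable_id : measurable_fun [set: cylI] (fun x => x : seqT X).
Proof.
apply: measurable_seqT => n _ E mE; rewrite setTI.
apply: sub_sigma_algebra; split.
  by rewrite -[X in measurable X]setTI; exact: measurable_coord.
by exists n.+1 => x y /(_ n (leqnn _)); rewrite /preimage/= => ->.
Qed.

Lemma ex_iid_measure : exists P : probability (seqT X) R,
  forall N (A : set (seqT X)), measurable A -> depends N A -> P A = nu p N A.
Proof.
exists (pushp ext measurable_id) => N A mA dA.
rewrite pushpE preimage_id -(cylmE p mA dA).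
rewrite /= /ext /measure_extension measurable_mu_extE//.
by rewrite cylTE; split => //; exists N.
Qed.

End cylinder_measure.

Section iid.
Context d (X : measurableType d) (R : realType) (p : probability X R).

Definition is_iid (P : probability (seqT X) R) := forall N (E : nat -> set X),
  (forall n, measurable (E n)) ->
  P [set x | forall n, (n < N)%N -> E n (x n)] = \prod_(n < N) p (E n).

Lemma measurable_box N (E : nat -> set X) : (forall n, measurable (E n)) ->
  measurable [set x : seqT X | forall n, (n < N)%N -> E n (x n)].
Proof.
move=> mE; rewrite [X in measurable X](_ : _ =
    \bigcap_(n in `I_N) ((fun x : seqT X => x n) @^-1` E n))//.
apply: bigcap_measurableType => n _.
by rewrite -[X in measurable X]setTI; exact: measurable_coord.
Qed.

Lemma nu_box N (E : nat -> set X) : (forall n, measurable (E n)) ->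
  nu p N [set x | forall n, (n < N)%N -> E n (x n)] = \prod_(n < N) p (E n).
Proof.
elim: N E => [|N IH] E mE.
  rewrite big_ord0 [X in nu p 0 X](_ : _ = setT) ?probability_setT//.
  by apply/seteqP; split.
rewrite nuSE big_ord_recl -(IH (fun n => E n.+1))//.
set B := [set x | forall n, (n < N)%N -> E n.+1 (x n)].
transitivity (\int[p]_a ((\1_(E 0%N) a)%:E * nu p N B)).
  apply: eq_integral => a _; rewrite indicE.
  have [aE|aE] := boolP (a \in E 0%N).
    rewrite mul1e; congr (nu p N _); apply/seteqP; split => x /= H n.
      by move=> nN; exact: (H n.+1 nN).
    by case: n => [|n] /= nN; [rewrite inE in aE|exact: H].
  rewrite mul0e [X in nu p N X](_ : _ = set0) ?measure0//.
  apply/seteqP; split => // x /= /(_ 0%N isT) /= Ea.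
  by move: aE; rewrite notin_setE.
rewrite ge0_integralZr//.
  by rewrite integral_indic ?setIT.
by apply/measurable_EFinP; exact: measurable_indic.
Qed.

Lemma ex_iid : exists P, is_iid P.
Proof.
have [P HP] := ex_iid_measure p; exists P => N E mE.
rewrite (HP N) ?nu_box//; first exact: measurable_box.
by move=> x y xy H n nN; rewrite -xy//; exact: H.
Qed.

End iid.

(** * The zero-one law *)

Section iid_theory.
Context d (X : measurableType d) (R : realType).
Implicit Types (p : probability X R) (P : probability (seqT X) R).

Definition box N (E : nat -> set X) : set (seqT X) :=
  [set x | forall n, (n < N)%N -> E n (x n)].

(** Boxes form a generating pi-system: the shorter of two is padded with [setT]. The measures are
    finite rather than normalized because restrictions and multiples of a probability are compared
    below. *)
Lemma measure_unique_box (m1 m2 : {measure set (seqT X) -> \bar R}) :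
  m1 setT < +oo ->
  (forall N E, (forall n, measurable (E n)) -> m1 (box N E) = m2 (box N E)) ->
  forall A, measurable A -> m1 A = m2 A.
Proof.
move=> m1oo m12 A mA.
pose G := [set B | exists N E, (forall n, measurable (E n)) /\ B = box N E].
have GT : G setT.
  by exists 0%N, (fun _ => setT); split => //; apply/seteqP; split.
apply: (measure_unique G (fun _ => setT)) => //.
- apply/seteqP; split; last first.
    apply: smallest_sub; first exact: sigma_algebra_measurable.
    by move=> _ [N [E [mE ->]]]; exact: measurable_box.
  apply: smallest_sub; first exact: smallest_sigma_algebra.
  move=> _ [n _ [E mE <-]]; apply: sub_sigma_algebra.
  exists n.+1, (fun k => if k == n then E else setT); split => [k|].
    by case: ifP.
  apply/seteqP; split => x /= H; last by have := H n (leqnn _); rewrite eqxx.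
  by move=> k _; case: eqP => // ->.
- move=> _ _ [N [E [mE ->]]] [M [F [mF ->]]].
  exists (maxn N M), (fun n => (if (n < N)%N then E n else setT) `&`
                             (if (n < M)%N then F n else setT)); split => [n|].
    by apply: measurableI; case: ifP.
  apply/seteqP; split => x /=.
    by move=> [HE HF] n _; split; case: ifP => // nN; first [exact: HE|exact: HF].
  move=> H; split => n nN; have := H n.
    by rewrite leq_max nN/= => /(_ isT)[].
  by rewrite leq_max nN orbT/= => /(_ isT)[].
- by rewrite bigcup_const//; exists 0%N.
- by move=> _ [N [E [mE ->]]]; exact: m12.
Qed.

Lemma iid_unique p P Q : is_iid p P -> is_iid p Q ->
  forall A, measurable A -> P A = Q A.
Proof.
move=> iP iQ; apply: measure_unique_box => [|N E mE].
  by rewrite ltey_eq fin_num_measure.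
by rewrite [LHS]iP// [RHS]iQ.
Qed.

Lemma measurable_iter_sshift n :
  measurable_fun [set: seqT X] (iter n (@sshift _ X)).
Proof.
elim: n => [|n IH]; first exact: measurable_id.
by apply: measurableT_comp IH; exact: measurable_sshift.
Qed.

Lemma iter_sshiftE n (x : seqT X) k : iter n (@sshift _ X) x k = x (n + k)%N.
Proof.
elim: n k => // n IH k.
by rewrite -[LHS]/(iter n (@sshift _ X) x k.+1) IH addnS.
Qed.

(** Independence of the past and the future. As functions of [A] both sides are finite measures;
    when [A] is a box, the intersection on the left is the box obtained by concatenation. *)
Lemma iid_box_iter_shift p P N E A : is_iid p P -> (forall n, measurable (E n)) ->
  measurable A ->
  P (box N E `&` iter N (@sshift _ X) @^-1` A) = P (box N E) * P A.
Proof.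
move=> iP mE mA.
have mB := measurable_box N mE.
have fB : P (box N E) \is a fin_num by exact: fin_num_measure.
have B0 : (0 <= fine (P (box N E)))%R by exact: fine_ge0.
pose m2 : {measure set (seqT X) -> \bar R} := mscale (NngNum B0) P.
have mS := measurable_iter_sshift N.
pose m1 := pushm (mrestr P mB) mS.
have m1E C : m1 C = P (box N E `&` iter N (@sshift _ X) @^-1` C).
  by rewrite /m1 pushmE /mrestr setIC.
have m2E C : m2 C = P (box N E) * P C by rewrite /m2/= /mscale/= fineK.
rewrite -m1E -m2E.
apply: (@measure_unique_box m1 m2) => //.
  rewrite m1E; apply: le_lt_trans (ltry 1).
  apply: probability_le1; apply: measurableI => //.
  by rewrite -[X in measurable X]setTI; exact: (mS measurableT).
move=> M F mF.
pose EF n := if (n < N)%N then E n else F (n - N)%N.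
have mEF n : measurable (EF n) by rewrite /EF; case: ifP.
have EFr n : EF (N + n)%N = F n by rewrite /EF ltnNge leq_addr/= addKn.
transitivity (P (box (N + M) EF)).
  rewrite m1E; congr (P _); apply/seteqP; split => x.
    move=> [HE HF] n nNM; rewrite /EF; case: ltnP => [/HE//|Nn].
    have := HF (n - N)%N; rewrite iter_sshiftE subnKC//; apply.
    by rewrite ltn_subLR.
  move=> H; split => n nN.
    by have := H n; rewrite /EF nN; apply; rewrite (leq_trans nN)// leq_addr.
  have := H (N + n)%N; rewrite EFr iter_sshiftE; apply.
  by rewrite ltn_add2l.
rewrite m2E [LHS]iP// [P (box N E)]iP// [P (box M F)]iP// big_split_ord/=.
congr (_ * _); apply: eq_bigr => i _; last by rewrite EFr.
by rewrite /EF ltn_ord.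
Qed.

Lemma iid_shift p P A : is_iid p P -> measurable A ->
  P (@sshift _ X @^-1` A) = P A.
Proof.
move=> iP mA.
have := @iid_box_iter_shift p P 1 (fun _ => setT) A iP _ mA.
rewrite (_ : box _ _ = setT); last by apply/seteqP; split.
by rewrite setTI probability_setT mul1e; exact.
Qed.

(* An invariant event is independent of the first [N] coordinates for all [N],
   hence independent of itself. *)
Lemma iid_zero_one p P k A : is_iid p P -> (0 < k)%N -> measurable A ->
  (forall x, A (iter k (@sshift _ X) x) <-> A x) -> P A = 0 \/ P A = 1.
Proof.
move=> iP k0 mA invA.
have invAm m : iter (m * k) (@sshift _ X) @^-1` A = A.
  apply/seteqP; split => x; rewrite /preimage/=; elim: m x => // m IH x.
    by rewrite mulSn addnC iterD => /IH /invA.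
  by rewrite mulSn addnC iterD => Ax; apply/IH/invA.
have fA : P A \is a fin_num by exact: fin_num_measure.
have A0 : (0 <= fine (P A))%R by exact: fine_ge0.
have AA : P (A `&` A) = P A * P A.
  pose m1 : {measure set (seqT X) -> \bar R} := mrestr P mA.
  pose m2 : {measure set (seqT X) -> \bar R} := mscale (NngNum A0) P.
  have m1E C : m1 C = P (C `&` A) by [].
  have m2E C : m2 C = P A * P C by rewrite /m2/= /mscale/= fineK.
  rewrite -m1E -m2E; apply: measure_unique_box => // [|N E mE].
    by rewrite m1E setTI ltey_eq fA.
  rewrite m1E m2E.
  pose E' n := if (n < N)%N then E n else setT.
  have mE' n : measurable (E' n) by rewrite /E'; case: ifP.
  (* [A] is invariant only under multiples of [k] shifts, so the box is padded to length [N * k],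
     which is at least [N] because [0 < k]. *)
  have -> : box N E = box (N * k) E'.
    apply/seteqP; split => x H n nN; rewrite /E'; first by case: ifP => // /H.
    by have := H n; rewrite /E' nN; apply; rewrite (leq_trans nN)// leq_pmulr.
  by rewrite -{1}(invAm N) (iid_box_iter_shift _ iP)// muleC.
move: AA; rewrite setIid -(fineK fA) -EFinM => -[/eqP].
rewrite -subr_eq0 -[X in (X - _)%R]mulr1 -mulrBr mulf_eq0 subr_eq0.
by move=> /orP[/eqP ->|/eqP <-]; [left|right].
Qed.

End iid_theory.

(** * The subadditive ergodic theorem *)

Section steele_covering.
Context (T : Type) (R : realType) (S : T -> T).
Implicit Types (g : nat -> T -> R) (G : T -> R).
Local Open Scope ring_scope.

Definition subadditive_along g :=
  forall m n x, g (m + n)%N x <= g m x + g n (iter m S x).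

Definition covering_bound (B : set T) G N n (x : T) : R :=
  \sum_(i < n) (\1_B (iter i S x) + (n <= i + N)%:R) * G (iter i S x).

Lemma covering_bound_shift B G N l k x : (forall x, 0 <= G x) ->
  covering_bound B G N k (iter l S x) <= covering_bound B G N (l + k) x.
Proof.
move=> G0; rewrite /covering_bound big_split_ord/= -[leLHS]add0r lerD//.
  by apply: sumr_ge0 => i _; rewrite mulr_ge0// addr_ge0// indicE.
apply: ler_sum => i _; rewrite -iterD addnC -addnA leq_add2l.
by rewrite (addnC l).
Qed.

Lemma subadditive_le_sum g G n x : subadditive_along g ->
  (forall x, g 0%N x <= 0) -> (forall x, g 1%N x <= G x) ->
  g n x <= \sum_(i < n) G (iter i S x).
Proof.
move=> sg g0 g1; elim: n x => [|n IH] x; first by rewrite big_ord0.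
rewrite big_ord_recl (le_trans (sg 1%N n x))// lerD// (le_trans (IH _))//.
by apply: ler_sum => i _; rewrite -iterSr.
Qed.

(* Steele's covering: outside [B] jump over a block on which [g] is
   nonpositive, at points of [B] pay one step of cost [G]; the last incomplete
   block costs at most [N] further steps. *)
Lemma subadditive_covering g G B N : subadditive_along g ->
  (forall x, g 0%N x <= 0) -> (forall x, g 1%N x <= G x) ->
  (forall x, 0 <= G x) ->
  (forall x, ~ B x -> exists l, [/\ (0 < l)%N, (l <= N)%N & g l x <= 0]) ->
  forall n x, g n x <= covering_bound B G N n x.
Proof.
move=> sg g0 g1 G0 gB n; elim/ltn_ind: n => -[|n] IH x.
  by rewrite /covering_bound big_ord0.
have [Bx|/gB[l [l0 lN gl]]] := pselect (B x).
  rewrite (le_trans (sg 1%N n x))//.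
  rewrite /covering_bound big_ord_recl lerD//.
    rewrite (le_trans (g1 _))// ler_peMl// indicE mem_set//= lerDl.
    by rewrite ler0n.
  rewrite (le_trans (IH n _ _))//.
  apply: ler_sum => i _; by rewrite lift0 -iterSr addSn ltnS.
have [ln|nl] := leqP l n.+1.
  have := sg l (n.+1 - l)%N x; rewrite subnKC// => /le_trans; apply.
  rewrite -[leRHS]add0r lerD// (le_trans (IH (n.+1 - l)%N _ _))//.
    by rewrite ltn_subrL l0.
  by rewrite -[X in covering_bound _ _ _ X x](subnKC ln) covering_bound_shift.
rewrite (le_trans (subadditive_le_sum _ _ sg g0 g1))//.
apply: ler_sum => i _; rewrite ler_peMl//.
have -> : (n.+1 <= i + N)%N.
  by rewrite (leq_trans _ (leq_addl _ _))// (leq_trans (ltnW nl)).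
by rewrite lerDr indicE.
Qed.

End steele_covering.

Section measure_preserving.
Context d (T : measurableType d) (R : realType) (P : probability T R).

Definition measure_preserving (S : T -> T) := measurable_fun [set: T] S /\
  forall A, measurable A -> P (S @^-1` A) = P A.

Definition ergodic (S : T -> T) := forall A, measurable A ->
  (forall x, A (S x) <-> A x) -> P A = 0 \/ P A = 1.

Context (S : T -> T) (mpS : measure_preserving S).

Lemma measure_preserving_iter n : measure_preserving (iter n S).
Proof.
case: mpS => mS PS; elim: n => [|n [mSn PSn]].
  by split => //; exact: measurable_id.
split => [|A mA]; first exact: measurableT_comp mS mSn.
have mSA : measurable (S @^-1` A).
  by rewrite -[X in measurable X]setTI; exact: mS.
by rewrite -(PS A mA) -(PSn _ mSA).
Qed.

Lemma measure_preserving_integral (f : T -> \bar R) :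
  measurable_fun [set: T] f -> (forall x, 0 <= f x) ->
  \int[P]_x f (S x) = \int[P]_x f x.
Proof.
case: mpS => mS PS mf f0; rewrite -(ge0_integral_pushp P mS mf f0).
by apply: eq_measure_integral => A mA _; rewrite -[RHS]PS.
Qed.

Lemma measure_preserving_ae (Q : T -> Prop) :
  {ae P, forall x, Q x} -> {ae P, forall x, Q (S x)}.
Proof.
case: mpS => mS PS [A [mA A0 QA]]; exists (S @^-1` A); split.
- by rewrite -[X in measurable X]setTI; exact: mS.
- by rewrite PS.
- by move=> x; exact: QA.
Qed.

End measure_preserving.

Section covering_integral.
Context d (T : measurableType d) (R : realType) (P : probability T R).
Context (S : T -> T) (mpS : measure_preserving P S).

Lemma sum_last_le n N :
  (\sum_(i < n) (n <= i + N)%N%:R <= (N%:R : R))%R.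
Proof.
suff H : (\sum_(i < n) (n <= i + N)%N <= minn n N)%N.
  by rewrite -natr_sum ler_nat (leq_trans H)// geq_minr.
elim: n => [|n IH]; first by rewrite big_ord0.
rewrite big_ord_recl.
under eq_bigr do rewrite lift0 addSn ltnS.
rewrite /= add0n (leq_trans (leq_add (leqnn _) IH))//.
have [nN|Nn] := ltnP n N.
  by rewrite (minn_idPl nN) add1n.
by rewrite (minn_idPr (leq_trans Nn (leqnSn _))).
Qed.

Lemma measurable_covering_bound (B : set T) (G : T -> R) N n : measurable B ->
  measurable_fun [set: T] G -> measurable_fun [set: T] (covering_bound S B G N n).
Proof.
move=> mB mG; apply: measurable_sum => i.
have [mS _] := measure_preserving_iter mpS i.
apply: measurable_funM; last exact: measurableT_comp mG mS.
apply: measurable_funD => //.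
exact: measurableT_comp (measurable_indic mB) mS.
Qed.

(** By invariance of the measure every term integrates as it would at time 0, and at most [N] of the
    [n] terms carry the tail indicator. *)
Lemma integral_covering_bound (B : set T) (G : T -> R) N n : measurable B ->
  measurable_fun [set: T] G -> (forall x, 0 <= G x)%R ->
  \int[P]_x (covering_bound S B G N n x)%:E <=
  n%:R%:E * \int[P]_x (\1_B x * G x)%:E + N%:R%:E * \int[P]_x (G x)%:E.
Proof.
move=> mB mG G0.
pose F (i : 'I_n) x := ((\1_B (iter i S x) + (n <= i + N)%:R) *
  G (iter i S x))%:E.
under eq_integral do rewrite /covering_bound -sumEFin -/(F _ _).
have mi (r : R) : measurable_fun [set: T] (fun x => (\1_B x + r) * G x)%R.
  by apply: measurable_funM => //; exact: measurable_funD.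
have i0 (t : R) x : (0 <= t -> 0 <= (\1_B x + t) * G x)%R.
  by move=> r0; rewrite mulr_ge0// addr_ge0// indicE.
rewrite (@ge0_integral_sum _ _ _ P _ measurableT _ F); last 2 first.
- move=> i; have [mS _] := measure_preserving_iter mpS i.
  apply/measurable_EFinP.
  exact: measurableT_comp (mi (n <= i + N)%:R) mS.
- by move=> i x _; rewrite lee_fin i0.
have IG0 : 0 <= \int[P]_x (G x)%:E.
  by apply: integral_ge0 => x _; rewrite lee_fin.
have E i : \int[P]_x F i x =
    \int[P]_x (\1_B x * G x)%:E + (n <= i + N)%:R%:E * \int[P]_x (G x)%:E.
  rewrite (measure_preserving_integral (measure_preserving_iter mpS i)
    (f := fun x => ((\1_B x + (n <= i + N)%:R) * G x)%:E)); last 2 first.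
  - by apply/measurable_EFinP; exact: mi.
  - by move=> x; rewrite lee_fin i0.
  under eq_integral do rewrite mulrDl EFinD.
  rewrite ge0_integralD//.
  - congr (_ + _); under eq_integral do rewrite EFinM.
    by rewrite ge0_integralZl_EFin//; [move=> x _; rewrite lee_fin|exact/measurable_EFinP].
  - by move=> x _; rewrite lee_fin mulr_ge0// indicE.
  - by apply/measurable_EFinP/measurable_funM => //; exact: measurable_indic.
  - by move=> x _; rewrite lee_fin mulr_ge0.
  - by apply/measurable_EFinP/measurable_funM.
under eq_bigr do rewrite E.
rewrite big_split/= -ge0_sume_distrl//.
set c := \int[P]_x (\1_B x * G x)%:E.
rewrite leeD//; last by rewrite lee_wpmul2r// sumEFin lee_fin sum_last_le.
under eq_bigr do rewrite -(mul1e c).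
by rewrite -ge0_sume_distrl// sumEFin sumr_const card_ord.
Qed.

End covering_integral.

Section subadditive_ergodic.
Context d (T : measurableType d) (R : realType) (P : probability T R).

Lemma measurable_ler_set (f g : T -> R) : measurable_fun [set: T] f ->
  measurable_fun [set: T] g -> measurable [set x | (f x <= g x)%R].
Proof.
move=> mf mg; have := measurable_fun_ler mf mg measurableT (Y := [set true]) I.
by rewrite setTI.
Qed.

Lemma measurable_ltr_set (f g : T -> R) : measurable_fun [set: T] f ->
  measurable_fun [set: T] g -> measurable [set x | (f x < g x)%R].
Proof.
move=> mf mg; have := measurable_fun_ltr mf mg measurableT (Y := [set true]) I.
by rewrite setTI.
Qed.

Lemma integral_indic_cvg0 (B : nat -> set T) (G : T -> R) :
  (forall N, measurable (B N)) -> measurable_fun [set: T] G ->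
  (forall x, 0 <= G x)%R -> \int[P]_x (G x)%:E < +oo ->
  {ae P, forall x, \forall N \near \oo, ~ B N x} ->
  \int[P]_x (\1_(B N) x * G x)%:E @[N --> \oo] --> 0.
Proof.
move=> mB mG G0 Goo aeB.
have [] // := @dominated_convergence _ _ _ P _ measurableT
    (fun N x => (\1_(B N) x * G x)%:E) (cst 0) (EFin \o G).
- by move=> N; apply/measurable_EFinP/measurable_funM.
- apply: filterS aeB => x Bx _; apply: cvg_near_cst.
  by apply: filterS Bx => N nB; rewrite indicE memNset//= mul0r.
- apply/integrableP; split; first exact/measurable_EFinP.
  by under eq_integral do rewrite /= ger0_norm//.
- apply: aeW => x N _; rewrite /= lee_fin ger0_norm ?mulr_ge0 ?indicE//.
  by rewrite ler_piMl// lern1 leq_b1.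
by move=> _ _; rewrite integral0.
Qed.

Context (S : T -> T) (mpS : measure_preserving P S).

(** Blocks on which [g] is at most [c] per step fill nearly all of a long orbit segment. The excess
    over [n * c] is bounded by the covering bound [h], of small integral: the bad points carry
    little of [G], and the last block is short compared with [n]. *)
Lemma subadditive_ae_bound (g : nat -> T -> R) (G : T -> R) (c : R) :
  (forall n, measurable_fun [set: T] (g n)) -> subadditive_along S g ->
  (forall x, g 0%N x <= 0)%R -> (forall x, g 1%N x <= G x)%R ->
  (forall x, 0 <= G x)%R -> measurable_fun [set: T] G ->
  \int[P]_x (G x)%:E < +oo ->
  {ae P, forall x, exists l, (0 < l)%N /\ (g l x <= l%:R * c)%R} ->
  forall e : R, (0 < e)%R -> exists n (h : T -> R),
    [/\ (0 < n)%N, measurable_fun [set: T] h, (forall x, 0 <= h x)%R,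
        (forall x, g n x <= n%:R * c + h x)%R &
        \int[P]_x (h x)%:E <= (n%:R * e)%:E].
Proof.
move=> mg sg g0 g1 G0 mG Goo aeg e e0.
(* Subtracting [n * c] moves the threshold to 0, as the covering lemma requires; adding [|c|] to [G]
   keeps it nonnegative and above [g' 1]. *)
pose g' n x := (g n x - n%:R * c)%R.
pose G' x := (G x + `|c|)%R.
have mg' n : measurable_fun [set: T] (g' n) by exact: measurable_funB.
have sg' : subadditive_along S g'.
  by move=> m n x; have := sg m n x; rewrite /g' natrD; lra.
have g'0 x : (g' 0%N x <= 0)%R by rewrite /g' mul0r subr0.
have g'1 x : (g' 1%N x <= G' x)%R.
  by rewrite /g' mul1r lerD// -normrN ler_norm.
have G'0 x : (0 <= G' x)%R by rewrite addr_ge0.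
have mG' : measurable_fun [set: T] G' by exact: measurable_funD.
have G'oo : \int[P]_x (G' x)%:E < +oo.
  rewrite /G'; under eq_integral do rewrite EFinD.
  rewrite ge0_integralD//; last 2 first.
  - by move=> x _; rewrite lee_fin.
  - exact/measurable_EFinP.
  by rewrite lte_add_pinfty// integral_cst// lte_mul_pinfty// ltey_eq fin_num_measure.
pose B N := [set x | forall l, (0 < l)%N -> (l <= N)%N -> (0 < g' l x)%R].
have mB N : measurable (B N).
  rewrite [B N](_ : _ = \bigcap_(l in [set l | (0 < l <= N)%N])
      [set x | (0 < g' l x)%R]).
    by apply: bigcap_measurableType => l _; exact: measurable_ltr_set.
  apply/seteqP; split => x H l; first by move=> /= /andP[]; exact: H.
  by move=> l0 lN; apply: H; rewrite /= l0.
have B0 : {ae P, forall x, \forall N \near \oo, ~ B N x}.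
  apply: filterS aeg => x [l [l0 gl]]; exists l => // N /= lN BN.
  by have := BN _ l0 lN; rewrite /g' subr_gt0 ltNge gl.
have e20 : 0%E < (e / 2)%:E by rewrite lte_fin divr_gt0.
have /(_ _ (open_ereal_lt' e20)) : _ `=>` _ :=
  integral_indic_cvg0 mB mG' G'0 G'oo B0.
move=> [N _ /(_ N (leqnn N)) /= intN].
have fG' : \int[P]_x (G' x)%:E \is a fin_num.
  by rewrite ge0_fin_numE//; apply: integral_ge0 => x _; rewrite lee_fin.
pose I := fine (\int[P]_x (G' x)%:E).
have I0 : (0 <= I)%R.
  by apply: fine_ge0; apply: integral_ge0 => x _; rewrite lee_fin.
(* Makes the tail term [N * I] at most [n * (e / 2)]; the bad set takes the other half of [e]. *)
pose n := (Num.truncn (N%:R * I / (e / 2))).+1.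
exists n, (covering_bound S (B N) G' N n); split => //.
- exact: (measurable_covering_bound mpS).
- move=> x; rewrite /covering_bound; apply: sumr_ge0 => i _.
  by rewrite mulr_ge0// addr_ge0// indicE.
- move=> x; rewrite -lerBlDl.
  apply: (subadditive_covering sg' g'0 g'1 G'0) => y.
  move=> /existsNP[l /not_implyP[l0 /not_implyP[lN /negP]]].
  by rewrite -leNgt => gl; exists l.
- apply: (le_trans (integral_covering_bound mpS N n (mB N) mG' G'0)).
  rewrite -(fineK fG') -/I -EFinM.
  rewrite [X in (n%:R * X)%:E]splitr mulrDr EFinD leeD//.
    by rewrite EFinM lee_wpmul2l// ltW.
  rewrite lee_fin -ler_pdivrMr ?divr_gt0//.
  exact/ltW/truncnS_gt.
Qed.

End subadditive_ergodic.

Section kingman.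
Context d (T : measurableType d) (R : realType) (P : probability T R).

Lemma integral_cst_prob (r : R) : \int[P]_x r%:E = r%:E.
Proof. by rewrite integral_cst// [X in _ * X]probability_setT mule1. Qed.

(** [D] is the event that the lower limit of [g n x / n] is at most [c], so by ergodicity it is null
    or full. If it were full, [subadditive_ae_bound] would push the mean of some [g n] below
    [n * lam]. *)
Lemma subadditive_liminf (S : T -> T) (g : nat -> T -> R) (G H : T -> R)
    (lam c : R) : measure_preserving P S -> ergodic P S ->
  (forall n, measurable_fun [set: T] (g n)) -> subadditive_along S g ->
  (forall x, g 0%N x <= 0)%R -> (forall x, g 1%N x <= G x)%R ->
  (forall x, 0 <= G x)%R -> measurable_fun [set: T] G ->
  \int[P]_x (G x)%:E < +oo ->
  (forall n x, `|g n.+1 x - g n (S x)| <= H x)%R ->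
  (forall n, P.-integrable [set: T] (EFin \o g n)) ->
  (forall n, (0 < n)%N -> (n%:R * lam)%:E <= \int[P]_x (g n x)%:E) ->
  (c < lam)%R ->
  {ae P, forall x, \forall n \near \oo, (n%:R * c < g n x)%R}.
Proof.
move=> mpS eS mg sg g0 g1 G0 mG Goo gH ig lamg clam.
pose cc k := (c + k.+1%:R^-1)%R.
pose D := [set x | forall k N, exists n, (N <= n)%N /\ (g n x <= n%:R * cc k)%R].
have mD : measurable D.
  rewrite [D](_ : _ = \bigcap_k \bigcap_N \bigcup_(n in [set n | (N <= n)%N])
      [set x | (g n x <= n%:R * cc k)%R]).
    apply: bigcapT_measurable => k; apply: bigcapT_measurable => N.
    by apply: bigcup_measurable => n _; exact: measurable_ler_set.
  apply/seteqP; split => x HD.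
    by move=> k _ N _; have [n [Nn gn]] := HD k N; exists n.
  by move=> k N; have [n Nn gn] := HD k I N I; exists n.
have ccS k : (cc k = cc k.*2.+1 + (k.*2.+2)%:R^-1)%R.
  rewrite /cc -doubleS -mul2n natrM invfM.
  by move: (k.+1%:R^-1)%R => a; lra.
have arch (a : R) k : exists M, forall n, (M <= n)%N -> (a <= n%:R / k.+1%:R)%R.
  exists (Num.truncn (a * k.+1%:R)).+1 => n Mn.
  rewrite ler_pdivlMr ?ltr0n// (le_trans (ltW (truncnS_gt _)))//.
  by rewrite ler_nat.
(* Moving between [x] and [S x] shifts the index by one and the value by at most [H x], an error
   that does not grow with [n]. Halving the slack, from [k] to [2k + 1], leaves [n / (2k + 2)] to
   absorb it, so [D] is invariant at every point. *)
have invD x : D (S x) <-> D x.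
  split => HD k N.
    have [M HM] := arch (H x + `|cc k|)%R k.*2.+1.
    have [n [Nn gn]] := HD k.*2.+1 (maxn N M).
    move: Nn; rewrite geq_max => /andP[Nn Mn]; exists n.+1.
    split; first exact: leqW.
    have := gH n x; rewrite ler_norml => /andP[_].
    have := HM _ Mn; have := ler_norm (- cc k)%R; rewrite normrN => h1 h2 h3.
    rewrite -natr1 mulrDl mul1r {1}(ccS k) mulrDr.
    by move: gn h2; move: (n%:R / _)%R (n%:R * _)%R => u v; lra.
  have [M HM] := arch (H x + `|cc k|)%R k.*2.+1.
  have [n [Nn gn]] := HD k.*2.+1 (maxn N M).+1.
  case: n Nn gn => // n; rewrite ltnS geq_max => /andP[Nn Mn] gn; exists n.
  split => //.
  have := gH n x; rewrite ler_norml => /andP[].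
  have := HM _ Mn; have := ler_norm (cc k)%R => h1 h2 h3 h4.
  have h5 : (cc k.*2.+1 <= cc k)%R by rewrite (ccS k) lerDl invr_ge0.
  have E : (n%:R * cc k = n%:R * cc k.*2.+1 + n%:R / k.*2.+2%:R)%R.
    by rewrite {1}(ccS k) [LHS]mulrDr.
  move: gn h2; rewrite E -natr1 mulrDl mul1r.
  by move: (n%:R * cc _)%R (n%:R / _)%R => u v; lra.
case: (eS D mD invD) => [PD0|PD1].
  apply: (@filterS _ _ _ (~` D)); last by exists D; split => //; rewrite setCK.
  move=> x /existsNP[k /existsNP[N nD]].
  exists (maxn 1 N) => // n /=; rewrite geq_max => /andP[n0 Nn].
  have : ~ (g n x <= n%:R * cc k)%R by move=> gn; apply: nD; exists n.
  move=> /negP; rewrite -ltNge; apply: le_lt_trans.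
  by rewrite ler_wpM2l// lerDl invr_ge0.
exfalso.
(* The gap [lam - c] must exceed two errors: the slack [1 / (k + 1) < e] and the [e] of
   [subadditive_ae_bound]. *)
pose e := ((lam - c) / 3)%R.
have e0 : (0 < e)%R by rewrite divr_gt0// subr_gt0.
have [k ke] : exists k, (k.+1%:R^-1 < e)%R.
  exists (Num.truncn e^-1); rewrite -[ltRHS]invrK ltf_pV2 ?posrE ?ltr0n ?invr_gt0//.
  exact: truncnS_gt.
have aeD : {ae P, forall x, exists l, (0 < l)%N /\ (g l x <= l%:R * cc k)%R}.
  apply: (@filterS _ _ _ D); first by move=> x /(_ k 1%N)[l []]; exists l.
  exists (~` D); split => //; first exact: measurableC.
  by rewrite probability_setC// PD1 subee.
have [n [h [n0 mh h0 gh inth]]] :=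
  subadditive_ae_bound mpS mg sg g0 g1 G0 mG Goo aeD e0.
have ih : P.-integrable [set: T] (EFin \o h).
  apply/integrableP; split; first exact/measurable_EFinP.
  under eq_integral do rewrite /= ger0_norm//.
  exact: le_lt_trans inth (ltry _).
have icst : P.-integrable [set: T] (EFin \o cst (n%:R * cc k)%R).
  exact: finite_measure_integrable_cst.
have : (n%:R * lam)%:E <= (n%:R * cc k + n%:R * e)%:E.
  apply: (le_trans (lamg _ n0)).
  apply: (@le_trans _ _ (\int[P]_x ((n%:R * cc k)%:E + (h x)%:E))).
    apply: le_integral => //; first exact: ig.
      exact: (integrableD measurableT icst ih).
    by move=> x _; rewrite -EFinD lee_fin.
  rewrite (integralD measurableT icst ih)//.
  by rewrite [X in X + _]integral_cst_prob EFinD leeD2l.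
rewrite lee_fin -mulrDr ler_pM2l ?ltr0n// /cc.
by move: ke; move: (k.+1%:R^-1)%R => a; rewrite /e; lra.
Qed.

End kingman.

Section kingman_theorem.
Context d (T : measurableType d) (R : realType) (P : probability T R).

Lemma integral_sum_iter (S : T -> T) (f : T -> R) k : measure_preserving P S ->
  measurable_fun [set: T] f -> (forall x, 0 <= f x)%R ->
  \int[P]_x (\sum_(i < k) f (iter i S x))%:E = k%:R%:E * \int[P]_x (f x)%:E.
Proof.
move=> mpS mf f0; under eq_integral do rewrite -sumEFin.
rewrite (@ge0_integral_sum _ _ _ P _ measurableT _
  (fun (i : 'I_k) x => (f (iter i S x))%:E)); last 2 first.
- move=> i; have [mS _] := measure_preserving_iter mpS i.
  by apply/measurable_EFinP; exact: measurableT_comp mf mS.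
- by move=> i x _; rewrite lee_fin.
set c := \int[P]_x (f x)%:E.
transitivity (\sum_(i < k) (1%:E * c)).
  apply: eq_bigr => i _; rewrite mul1e.
  apply: (measure_preserving_integral (measure_preserving_iter mpS i)
    (f := fun x => (f x)%:E)); first exact/measurable_EFinP.
  by move=> x; rewrite lee_fin.
by rewrite -ge0_sume_distrl// sumEFin sumr_const card_ord.
Qed.

Context (S : T -> T) (g : nat -> T -> R) (H : T -> R) (lam : R).
Hypothesis mpS : measure_preserving P S.
(** All iterates are involved because the upper bound runs over blocks of length [m]. *)
Hypothesis eS : forall m, (0 < m)%N -> ergodic P (iter m S).
Hypothesis mg : forall n, measurable_fun [set: T] (g n).
Hypothesis sg : subadditive_along S g.
Hypothesis g00 : forall x, (g 0%N x = 0)%R.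
Hypothesis g_ge0 : forall n x, (0 <= g n x)%R.
Hypothesis g1oo : \int[P]_x (g 1%N x)%:E < +oo.
Hypothesis gH : forall n x, (`|g n.+1 x - g n (S x)| <= H x)%R.
Hypothesis lamg : forall n, (0 < n)%N -> (n%:R * lam)%:E <= \int[P]_x (g n x)%:E.
Hypothesis glam : forall e : R, (0 < e)%R -> exists m, (0 < m)%N /\
  \int[P]_x (g m x)%:E <= (m%:R * (lam + e))%:E.

Let integral_lty n : \int[P]_x (g n x)%:E < +oo.
Proof.
elim: n => [|n IH].
  by under eq_integral do rewrite g00; rewrite integral0 ltry.
apply: (@le_lt_trans _ _ (\int[P]_x ((g 1%N x)%:E + (g n (S x))%:E))).
  apply: ge0_le_integral => //.
  - by move=> x _; rewrite lee_fin.
  - exact/measurable_EFinP.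
  - apply: emeasurable_funD; first exact/measurable_EFinP.
    apply/measurable_EFinP; exact: measurableT_comp (mg n) mpS.1.
  - by move=> x _; rewrite -EFinD lee_fin; exact: (sg 1%N n x).
rewrite ge0_integralD//; last 4 first.
- by move=> x _; rewrite lee_fin.
- exact/measurable_EFinP.
- by move=> x _; rewrite lee_fin.
- by apply/measurable_EFinP; exact: measurableT_comp (mg n) mpS.1.
rewrite lte_add_pinfty//.
rewrite (measure_preserving_integral mpS (f := fun x => (g n x)%:E))//.
- exact/measurable_EFinP.
- by move=> x; rewrite lee_fin.
Qed.

Let ig n : P.-integrable [set: T] (EFin \o g n).
Proof.
apply/integrableP; split; first exact/measurable_EFinP.
under eq_integral do rewrite /= ger0_norm//.
exact: integral_lty.
Qed.

(** The sums [s k] of [g m] over [k] consecutive blocks dominate [g (k * m)]. Their negatives are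
    additive, so [subadditive_liminf] applies to them and bounds [s] from above. One third of [e]
    pays for the choice of [m], one for the lower limit, one for the incomplete block. *)
Let kingman_upper (e : R) : (0 < e)%R ->
  {ae P, forall x, \forall n \near \oo, (g n x < n%:R * (lam + e))%R}.
Proof.
move=> e0; have [|m [m0 Em]] := @glam (e / 3)%R; first by rewrite divr_gt0.
have mR : (0 < m%:R :> R)%R by rewrite ltr0n.
(* The sign allows [n %/ m * m] to be replaced by the larger [n] in [h3]. *)
have lam0 : (0 <= lam + e / 3)%R.
  rewrite -(pmulr_rge0 _ mR) -lee_fin (le_trans _ Em)//.
  by apply: integral_ge0 => x _; rewrite lee_fin.
pose S' := iter m S; pose s k x := (\sum_(i < k) g m (iter i S' x))%R.
have mpS' : measure_preserving P S' := measure_preserving_iter mpS m.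
have ms k : measurable_fun [set: T] (s k).
  apply: measurable_sum => i; have [mSi _] := measure_preserving_iter mpS' i.
  exact: measurableT_comp (mg m) mSi.
have s0 k x : (0 <= s k x)%R by apply: sumr_ge0.
have ints k : \int[P]_x (s k x)%:E <= (k%:R * (m%:R * (lam + e / 3)))%:E.
  by rewrite integral_sum_iter// EFinM lee_wpmul2l.
have sS k x : s k.+1 x = (g m x + s k (S' x))%R.
  rewrite /s big_ord_recl; congr (_ + _)%R.
  by apply: eq_bigr => i _; rewrite lift0 iterSr.
have sD j k x : s (j + k)%N x = (s j x + s k (iter j S' x))%R.
  elim: j x => [|j IH] x; first by rewrite /s big_ord0 add0r.
  by rewrite addSn !sS IH addrA -iterSr.
have {}ints : {ae P, forall x, \forall k \near \oo,
    (k%:R * - (m%:R * (lam + e / 3 * 2)) < - s k x)%R}.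
  apply: (@subadditive_liminf _ _ _ P S' (fun k x => - s k x)%R (cst 0%R) (g m)
    (- (m%:R * (lam + e / 3)))%R (- (m%:R * (lam + e / 3 * 2)))%R) => //.
  - exact: eS.
  - by move=> k; exact: measurable_funN.
  - by move=> j k x; rewrite sD opprD.
  - by move=> x; rewrite /s big_ord0 oppr0.
  - by move=> x; rewrite oppr_le0.
  - by rewrite integral0 ltry.
  - by move=> k x; rewrite sS opprD opprK subrK normrN ger0_norm.
  - move=> k; apply/integrableP; split.
      by apply/measurable_EFinP; exact: measurable_funN.
    under eq_integral do rewrite /= normrN ger0_norm//.
    by rewrite (le_lt_trans (ints k))// ltry.
  - move=> k _; under eq_integral do rewrite EFinN.
    rewrite integral_ge0N => [|x _]; last by rewrite lee_fin.
    by rewrite leeNr -EFinN mulrN opprK.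
  - by rewrite ltrN2 ltr_pM2l//; move: e0; lra.
have gs k x : (g (k * m)%N x <= s k x)%R.
  elim: k x => [|k IH] x; first by rewrite mul0n g00.
  by rewrite mulSn sS (le_trans (sg _ _ _))// lerD2l.
(* The remainder [n %% m] is placed before the blocks. Its cost is then one of the [m] numbers
   [g r x], bounded independently of [n], at the price of needing the block estimate at every
   [iter r S x]. *)
have {}ints : {ae P, forall x, forall r, \forall k \near \oo,
    (s k (iter r S x) < k%:R * (m%:R * (lam + e / 3 * 2)))%R}.
  apply/ae_foralln => r.
  have := measure_preserving_ae (measure_preserving_iter mpS r) ints.
  apply: filterS => x; apply: filterS => k.
  by rewrite mulrN ltrN2.
apply: filterS ints => x ints.
have /choice[K HK] : forall r, exists K, forall k, (K <= k)%N ->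
    (s k (iter r S x) < k%:R * (m%:R * (lam + e / 3 * 2)))%R.
  by move=> r; have [K _ HK] := ints r; exists K => k /HK.
pose K0 := \max_(r < m) K r; pose M := (\sum_(r < m) g r x)%R.
have M0 : (0 <= M)%R by apply: sumr_ge0.
(* The first summand makes [n %/ m] reach every [K r] with [r < m], the second makes [M] smaller
   than [n * (e / 3)]. *)
exists (K0.+1 * m + (Num.truncn (M / (e / 3))%R).+1)%N => // n /= Nn.
have rm : (n %% m < m)%N by rewrite ltn_mod.
have kK : (K (n %% m)%N <= n %/ m)%N.
  apply: (@leq_trans K0); first exact: (leq_bigmax (Ordinal rm)).
  rewrite leq_divRL// (leq_trans _ Nn)// (leq_trans _ (leq_addr _ _))//.
  by rewrite leq_mul2r leqnSn orbT.
have gM : (g (n %% m) x <= M)%R.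
  rewrite /M (bigD1 (Ordinal rm))//= lerDl; exact: sumr_ge0.
have Me : (M < n%:R * (e / 3))%R.
  rewrite -ltr_pdivrMr ?divr_gt0// (lt_le_trans (truncnS_gt _))// ler_nat.
  exact: leq_trans (leq_addl _ _) Nn.
have := sg (n %% m)%N (n %/ m * m)%N x; rewrite addnC -divn_eq => gn.
have h1 := HK _ _ kK; have h2 := gs (n %/ m)%N (iter (n %% m) S x).
have h3 : ((n %/ m)%:R * (m%:R * (lam + e / 3 * 2)) <= n%:R * (lam + e / 3 * 2))%R.
  rewrite mulrA -natrM ler_wpM2r ?ler_nat ?leq_divM//.
  by move: lam0 e0; lra.
move: Me h3; rewrite (_ : n%:R * (lam + e) = n%:R * (lam + e / 3 * 2) +
  n%:R * (e / 3))%R; first lra.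
by rewrite -mulrDr; congr (_ * _)%R; lra.
Qed.

Theorem kingman :
  {ae P, forall x, (n%:R^-1 * g n x)%R @[n --> \oo] --> lam}.
Proof.
have up : {ae P, forall x, forall j, \forall n \near \oo,
    (g n x < n%:R * (lam + j.+1%:R^-1))%R}.
  by apply/ae_foralln => j; apply: kingman_upper; rewrite invr_gt0.
have lo : {ae P, forall x, forall j, \forall n \near \oo,
    (n%:R * (lam - j.+1%:R^-1) < g n x)%R}.
  apply/ae_foralln => j.
  apply: (subadditive_liminf mpS _ mg sg _ _ (g_ge0 1%N) (mg 1%N) g1oo gH ig lamg).
  - exact: (eS (ltn0Sn 0)).
  - by move=> x; rewrite g00.
  - by [].
  - by rewrite gtrBl invr_gt0.
apply: filterS2 up lo => x up lo.
apply/cvgrPdist_lt => e e0.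
pose j := Num.truncn e^-1.
have je : (j.+1%:R^-1 < e)%R.
  rewrite -[ltRHS]invrK ltf_pV2 ?posrE ?ltr0n ?invr_gt0//.
  exact: truncnS_gt.
near=> n.
have n0 : (0 < n%:R :> R)%R by rewrite ltr0n; near: n; exact: nbhs_infty_gt.
have h1 : (g n x < n%:R * (lam + j.+1%:R^-1))%R by near: n; exact: up.
have h2 : (n%:R * (lam - j.+1%:R^-1) < g n x)%R by near: n; exact: lo.
rewrite ltr_distlC (mulrC (n%:R^-1)%R) ltr_pdivlMr// ltr_pdivrMr//.
apply/andP; split.
  rewrite mulrC (le_lt_trans _ h2)// ler_pM2l//.
  by rewrite lerB// ltW.
rewrite mulrC (lt_le_trans h1)// ler_pM2l//.
by rewrite lerD// ltW.
Unshelve. all: by end_near. Qed.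

End kingman_theorem.

(** * Random walks *)

Section iid_scons.
Context d (X : measurableType d) (R : realType).
Variables (p : probability X R) (P : probability (seqT X) R).

Lemma iid_scons : is_iid p P ->
  is_iid p (pushp (prodp p P) (@measurable_scons_pair _ X)).
Proof.
move=> iP [|N] E mE.
  rewrite big_ord0 [X in pushp _ _ X](_ : _ = setT) ?probability_setT//.
  by apply/seteqP; split.
rewrite pushpE [X in prodp _ _ X](_ : _ = E 0%N `*` box N (fun n => E n.+1)).
  rewrite [LHS]product_measure1E//; last exact: measurable_box.
  by rewrite big_ord_recl; congr (_ * _); rewrite [LHS]iP.
apply/seteqP; split => -[a x] /=.
  by move=> HE; split; [exact: (HE 0%N)|move=> n nN; exact: (HE n.+1)].
by move=> [Ea HE] [|n] //=; exact: HE.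
Qed.

(** Prepending an independent letter preserves the i.i.d. law, by uniqueness; Tonelli then splits
    off the first coordinate. *)
Lemma iid_integral_scons (f : seqT X -> \bar R) : is_iid p P ->
  measurable_fun [set: seqT X] f -> (forall x, 0 <= f x) ->
  \int[P]_x f x = \int[p]_a \int[P]_x f (scons a x).
Proof.
move=> iP mf f0.
transitivity (\int[pushp (prodp p P) (@measurable_scons_pair _ X)]_x f x).
  by apply: eq_measure_integral => A mA _; exact: iid_unique (iid_scons iP) _ mA.
rewrite ge0_integral_pushp// (@fubini_tonelli1 _ _ _ _ _ p P)//.
exact: measurableT_comp mf (@measurable_scons_pair _ X).
Qed.

End iid_scons.

Section random_walk.
Context d (X : measurableType d) (R : realType).
(** The monoid is abstract because it is instantiated with the product of SL(2,R) and with its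
    opposite. *)
Variables (op : X -> X -> X) (e : X) (N : X -> R).
Hypothesis opA : associative op.
Hypothesis op1 : left_id e op.
Hypothesis opr1 : right_id e op.
Hypothesis mop : measurable_fun [set: X * X] (fun z => op z.1 z.2).
Hypothesis mN : measurable_fun [set: X] N.
Hypothesis N0 : N e = 0%R.
Hypothesis N_ge0 : forall a, (0 <= N a)%R.
Hypothesis N_op : forall a b, (N (op a b) <= N a + N b)%R.
(** Replaces the symmetry of [N] under inversion without mentioning inverses. With [N_op] it gives
    the hypothesis [gH] of [kingman] for [H x = N (x 0)]. *)
Hypothesis N_opl : forall a b, (N a <= N (op a b) + N b)%R.

Fixpoint walk (x : nat -> X) n := if n is k.+1 then op (x k) (walk x k) else e.

Lemma walkD x m n :
  walk x (m + n) = op (walk (iter m (@sshift _ X) x) n) (walk x m).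
Proof.
elim: n => [|n IH]; first by rewrite addn0 op1.
by rewrite addnS /= IH opA iter_sshiftE.
Qed.

Lemma walkSr x n : walk x n.+1 = op (walk (sshift x) n) (x 0%N).
Proof. by rewrite -add1n walkD /= opr1. Qed.

Lemma measurable_op d' (T : measurableType d') (f g : T -> X) :
  measurable_fun [set: T] f -> measurable_fun [set: T] g ->
  measurable_fun [set: T] (fun t => op (f t) (g t)).
Proof.
by move=> mf mg; exact: measurableT_comp mop (measurable_fun_pair mf mg).
Qed.

Lemma measurable_walk n : measurable_fun [set: seqT X] (fun x => walk x n).
Proof.
elim: n => [|n IH]; first exact: measurable_cst.
by apply: measurable_op => //; exact: measurable_coord.
Qed.

Section transfer_operator.
Variable p : probability X R.

Definition transfer (f : X -> \bar R) (b : X) : \bar R := \int[p]_a f (op a b).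

Definition mean n : \bar R := iter n transfer (EFin \o N) e.

Definition drift : R :=
  fine (ereal_inf [set n%:R^-1%:E * mean n | n in [set n | (0 < n)%N]]).

Lemma transfer_ge0 f : (forall b, 0 <= f b) -> forall b, 0 <= transfer f b.
Proof. by move=> f0 b; apply: integral_ge0. Qed.

Lemma measurable_transfer f : measurable_fun [set: X] f -> (forall b, 0 <= f b) ->
  measurable_fun [set: X] (transfer f).
Proof.
move=> mf f0.
apply: (@measurable_fun_fubini_tonelli_G _ _ X X R p (fun z => f (op z.1 z.2))).
  exact: measurableT_comp mf mop.
by move=> z; exact: f0.
Qed.

Lemma iter_transfer_ge0 n f : (forall b, 0 <= f b) ->
  forall b, 0 <= iter n transfer f b.
Proof. by move=> f0; elim: n => //= n IH; exact: transfer_ge0. Qed.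

Lemma measurable_iter_transfer n f : measurable_fun [set: X] f ->
  (forall b, 0 <= f b) -> measurable_fun [set: X] (iter n transfer f).
Proof.
move=> mf f0; elim: n => //= n IH; apply: measurable_transfer => //.
exact: iter_transfer_ge0.
Qed.

Lemma integral_walk (P : probability (seqT X) R) f n b : is_iid p P ->
  measurable_fun [set: X] f -> (forall b, 0 <= f b) ->
  \int[P]_x f (op (walk x n) b) = iter n transfer f b.
Proof.
move=> iP mf f0; elim: n b => [|n IH] b.
  rewrite /= op1.
  by rewrite integral_cst// [X in _ * X]probability_setT mule1.
rewrite (iid_integral_scons iP)//; last first.
  apply: (measurableT_comp mf); apply: measurable_op => //.
  exact: measurable_walk.
rewrite iterS /transfer; apply: eq_integral => a _.
by rewrite -IH; apply: eq_integral => x _; rewrite walkSr -opA.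
Qed.

Lemma integral_length_walk (P : probability (seqT X) R) n : is_iid p P ->
  \int[P]_x (N (walk x n))%:E = mean n.
Proof.
move=> iP.
have mEN : measurable_fun [set: X] (EFin \o N) by exact/measurable_EFinP.
have EN0 b : 0 <= (EFin \o N) b by rewrite lee_fin.
rewrite /mean -(integral_walk n e iP mEN EN0).
by apply: eq_integral => x _; rewrite opr1.
Qed.

Lemma mean_ge0 n : 0 <= mean n.
Proof. by apply: iter_transfer_ge0 => b; rewrite lee_fin. Qed.

Lemma mean1 : mean 1 = \int[p]_a (N a)%:E.
Proof. by apply: eq_integral => a _; rewrite /= opr1. Qed.

Hypothesis N_lty : \int[p]_a (N a)%:E < +oo.

Lemma driftE : drift%:E =
  ereal_inf [set n%:R^-1%:E * mean n | n in [set n | (0 < n)%N]].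
Proof.
rewrite /drift fineK// ge0_fin_numE; last first.
  apply: le_ereal_inf_tmp => _ [n n0 <-].
  by rewrite mule_ge0 ?mean_ge0// lee_fin invr_ge0.
apply: le_lt_trans N_lty; apply: ereal_inf_lbound; exists 1%N => //.
by rewrite invr1 mul1e mean1.
Qed.

Lemma drift_le n : (0 < n)%N -> (n%:R * drift)%:E <= mean n.
Proof.
move=> n0; have n0R : (0 < n%:R :> R)%R by rewrite ltr0n.
have : drift%:E <= n%:R^-1%:E * mean n.
  by rewrite driftE; apply: ereal_inf_lbound; exists n.
by rewrite lee_pdivlMl// EFinM.
Qed.

Lemma drift_approx (eps : R) : (0 < eps)%R ->
  exists m, (0 < m)%N /\ mean m <= (m%:R * (drift + eps))%:E.
Proof.
move=> eps0; have : drift%:E < (drift + eps)%:E by rewrite lte_fin ltrDl.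
rewrite {1}driftE => /ereal_inf_lt[_ [m m0 <-]] h; exists m; split => //.
have m0R : (0 < m%:R :> R)%R by rewrite ltr0n.
by rewrite EFinM -lee_pdivrMl// ltW.
Qed.

Lemma ae_cvg_walk (P : probability (seqT X) R) : is_iid p P ->
  {ae P, forall x, (n%:R^-1 * N (walk x n))%R @[n --> \oo] --> drift}.
Proof.
move=> iP.
have mpS : measure_preserving P (@sshift _ X).
  split; first exact: measurable_sshift.
  by move=> A mA; exact: iid_shift iP mA.
apply: (kingman (S := @sshift _ X) (g := fun n x => N (walk x n))
  (H := fun x => N (x 0%N))) => //.
- by move=> m m0 A mA invA; exact: iid_zero_one iP m0 mA invA.
- by move=> n; exact: measurableT_comp mN (measurable_walk n).
- by move=> m n x; rewrite walkD addrC.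
- by rewrite integral_length_walk// mean1.
- move=> n x; rewrite walkSr ler_norml.
  have := N_opl (walk (sshift x) n) (x 0%N).
  by have := N_op (walk (sshift x) n) (x 0%N); lra.
- by move=> n n0; rewrite integral_length_walk// drift_le.
- move=> eps /drift_approx[m [m0 h]]; exists m; split => //.
  by rewrite integral_length_walk.
Qed.

End transfer_operator.

End random_walk.

Section flipped_walk.
Context d (X : measurableType d) (R : realType).
Variables (op : X -> X -> X) (e : X) (N : X -> R) (p : probability X R).
Hypothesis opA : associative op.
Hypothesis op1 : left_id e op.
Hypothesis opr1 : right_id e op.
Hypothesis mop : measurable_fun [set: X * X] (fun z => op z.1 z.2).
Hypothesis mN : measurable_fun [set: X] N.
Hypothesis N_ge0 : forall a, (0 <= N a)%R.

Let flip_op a b := op b a.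

Let mflip : measurable_fun [set: X * X] (fun z => flip_op z.1 z.2).
Proof.
exact: (measurable_op mop measurable_snd measurable_fst).
Qed.

Let transferC f : measurable_fun [set: X] f -> (forall b, 0 <= f b) ->
  transfer op p (transfer flip_op p f) = transfer flip_op p (transfer op p f).
Proof.
move=> mf f0; apply/funext => b; rewrite /transfer /flip_op.
under [RHS]eq_integral do under eq_integral do rewrite opA.
rewrite (@fubini_tonelli _ _ X X R p p (fun z => f (op (op z.1 b) z.2)))//.
apply: (measurableT_comp mf).
apply: (measurable_op mop); last exact: measurable_snd.
by apply: (measurable_op mop) => //; exact: measurable_fst.
Qed.

(** At the point [e] a left step and a right step agree. Commutation moves the step to be exchanged
    to the outermost place, where it is evaluated at [e]. *)
Lemma mean_flip n : mean flip_op e N p n = mean op e N p n.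
Proof.
have iterC f m : measurable_fun [set: X] f -> (forall b, 0 <= f b) ->
    iter m (transfer op p) (transfer flip_op p f) =
    transfer flip_op p (iter m (transfer op p) f).
  move=> mf f0; elim: m => //= m ->; rewrite transferC//.
    exact: measurable_iter_transfer.
  exact: iter_transfer_ge0.
rewrite /mean.
have : measurable_fun [set: X] (EFin \o N) by exact/measurable_EFinP.
have : forall b, 0 <= (EFin \o N) b by move=> b; rewrite lee_fin.
move: (EFin \o N) => f f0 mf; elim: n f f0 mf => // n IH f f0 mf.
rewrite iterSr IH; last 2 first.
- exact: transfer_ge0.
- exact: measurable_transfer.
rewrite iterC// iterS /transfer /flip_op.
by apply: eq_integral => a _; rewrite op1 opr1.
Qed.

Lemma drift_flip : drift flip_op e N p = drift op e N p.
Proof.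
rewrite /drift; suff -> : mean flip_op e N p = mean op e N p by [].
by apply/funext => n; exact: mean_flip.
Qed.

End flipped_walk.

(** * The group SL(2,R) *)

Section operator_norm_theory.
Context {R : realType}.
Implicit Types (v w : 'cV[R]_2) (A B : 'M[R]_2).
Local Open Scope ring_scope.

Lemma mulmx_cV2 A v k :
  (A *m v) k ord0 = A k ord0 * v ord0 ord0 + A k ord_max * v ord_max ord0.
Proof.
rewrite mxE big_ord_recl big_ord1.
by congr (_ + A k _ * v _ _); exact: val_inj.
Qed.

Lemma enorm_cauchy_schwarz v w :
  v ord0 ord0 * w ord0 ord0 + v ord_max ord0 * w ord_max ord0 <=
  enorm v * enorm w.
Proof.
apply: (le_trans (ler_norm _)).
rewrite -(ler_pXn2r (ltn0Sn 1)) ?nnegrE ?mulr_ge0 ?enorm_ge0 ?normr_ge0//.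
rewrite real_normK ?num_real// exprMn !enorm_sqr -subr_ge0.
by rewrite [leRHS](_ : _ = (v ord0 ord0 * w ord_max ord0 -
  v ord_max ord0 * w ord0 ord0) ^+ 2) ?sqr_ge0//; ring.
Qed.

Lemma enormZ (c : R) v : enorm (c *: v) = `|c| * enorm v.
Proof.
apply/eqP; rewrite -(eqrXn2 (n := 2)) ?mulr_ge0 ?enorm_ge0// exprMn !enorm_sqr.
by rewrite !mxE real_normK ?num_real//; apply/eqP; ring.
Qed.

Lemma enorm_eq0 v : enorm v = 0 -> v = 0.
Proof.
move=> v0; have := enorm_sqr v; rewrite v0 expr0n/= => /esym/eqP.
rewrite paddr_eq0 ?sqr_ge0// !sqrf_eq0 => /andP[/eqP h0 /eqP h1].
apply/colP => i; rewrite !mxE -[RHS]h0.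
have [->|i0] := eqVneq i ord0; first by [].
have -> : i = ord_max by apply/val_inj; case: i i0 => -[|[]].
by rewrite h0 h1.
Qed.

Lemma opnorm_ge0 A : 0 <= opnorm A.
Proof.
by apply: le_trans (enorm_ge0 (A *m 0)) (opnorm_ub _ _); rewrite enorm0 ler01.
Qed.

Lemma enorm_mulmx A v : enorm (A *m v) <= opnorm A * enorm v.
Proof.
have [v0|v0] := eqVneq (enorm v) 0.
  by rewrite v0 mulr0 (enorm_eq0 v0) mulmx0 enorm0.
have vp : 0 < enorm v by rewrite lt_neqAle eq_sym v0 enorm_ge0.
rewrite -ler_pdivrMr//.
have -> : enorm (A *m v) / enorm v = enorm (A *m ((enorm v)^-1 *: v)).
  by rewrite -scalemxAr enormZ ger0_norm ?invr_ge0 ?enorm_ge0// mulrC.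
by apply: opnorm_ub; rewrite enormZ ger0_norm ?invr_ge0 ?enorm_ge0// mulVf.
Qed.

Lemma opnormM A B : opnorm (A *m B) <= opnorm A * opnorm B.
Proof.
apply: opnorm_le => v v1; rewrite -mulmxA (le_trans (enorm_mulmx _ _))//.
by rewrite ler_wpM2l ?opnorm_ge0// opnorm_ub.
Qed.

Lemma opnorm1 : opnorm (1%:M : 'M[R]_2) = 1.
Proof.
have e1 : enorm (delta_mx ord0 ord0 : 'cV[R]_2) = 1.
  apply/eqP; rewrite -(eqrXn2 (n := 2)) ?enorm_ge0// enorm_sqr !mxE /=.
  by rewrite expr1n expr0n addr0.
apply/eqP; rewrite eq_le; apply/andP; split.
  by apply: opnorm_le => v; rewrite mul1mx.
by rewrite -[leLHS]e1 -[X in enorm X <= _]mul1mx opnorm_ub ?e1.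
Qed.

Lemma le_entry_opnorm A i j : `|A i j| <= opnorm A.
Proof.
have e1 : enorm (delta_mx j ord0 : 'cV[R]_2) <= 1.
  rewrite /enorm (bigD1 j)//= mxE !eqxx expr1n big1 ?addr0 ?sqrtr1// => k kj.
  by rewrite mxE (negbTE kj) expr0n.
apply: le_trans (opnorm_ub A e1); rewrite -colE -sqrtr_sqr /enorm ler_wsqrtr//.
rewrite (bigD1 i)//= mxE lerDl; apply: sumr_ge0 => k _; exact: sqr_ge0.
Qed.

Lemma opnorm_le_sum A : opnorm A <= \sum_i \sum_j `|A i j|.
Proof.
apply: opnorm_le => v v1.
have coord i : `|v i ord0| <= 1.
  apply: le_trans v1; rewrite -sqrtr_sqr ler_wsqrtr//.
  by rewrite (bigD1 i)//= lerDl; apply: sumr_ge0 => k _; exact: sqr_ge0.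
have enorm_le w : enorm w <= \sum_i `|w i ord0|.
  rewrite -(ler_pXn2r (ltn0Sn 1)) ?nnegrE ?enorm_ge0 ?sumr_ge0//.
  rewrite enorm_sqr big_ord_recl big_ord1.
  rewrite (_ : lift _ _ = ord_max); last exact: val_inj.
  by rewrite sqrrD !real_normK ?num_real// lerD2r lerDl mulrn_wge0// mulr_ge0.
apply: (le_trans (enorm_le _)); apply: ler_sum => i _; rewrite mxE.
apply: (le_trans (ler_norm_sum _ _ _)); apply: ler_sum => j _.
by rewrite normrM ler_piMr// coord.
Qed.

Lemma adj_mx2 A : [/\ \adj A ord0 ord0 = A ord_max ord_max,
  \adj A ord0 ord_max = - A ord0 ord_max,
  \adj A ord_max ord0 = - A ord_max ord0 &
  \adj A ord_max ord_max = A ord0 ord0].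
Proof.
have l0 : lift (ord0 : 'I_2) (ord0 : 'I_1) = ord_max by exact: val_inj.
have l1 : lift (ord_max : 'I_2) (ord0 : 'I_1) = ord0 by exact: val_inj.
by split; rewrite !mxE /cofactor [\det _]det_mx11 !mxE ?l0 ?l1 /= ?expr0
  ?expr1 ?mul1r ?mulN1r// addn1 sqrrN expr1n mul1r.
Qed.

(* [<adj A v, w> = <A w', v'>] with [w'], [v'] the images of [w], [v] under a
   quarter turn. *)
Lemma opnorm_adj A : opnorm (\adj A) <= opnorm A.
Proof.
pose rot (v : 'cV[R]_2) : 'cV[R]_2 :=
  \col_i (if i == ord0 then v ord_max ord0 else - v ord0 ord0).
have rotE v : enorm (rot v) = enorm v.
  apply/eqP; rewrite -(eqrXn2 (n := 2)) ?enorm_ge0// !enorm_sqr !mxE/=.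
  by apply/eqP; ring.
apply: opnorm_le => v v1; set u := \adj A *m v.
have [u0|u0] := eqVneq (enorm u) 0; first by rewrite u0 opnorm_ge0.
have up : 0 < enorm u by rewrite lt_neqAle eq_sym u0 enorm_ge0.
rewrite -(ler_pM2r up) -expr2.
apply: (@le_trans _ _ (enorm (A *m rot u) * enorm (rot v))).
  apply: le_trans (enorm_cauchy_schwarz _ _); rewrite enorm_sqr.
  have [a00 a01 a10 a11] := adj_mx2 A.
  have u0E : u ord0 ord0 = A ord_max ord_max * v ord0 ord0 -
      A ord0 ord_max * v ord_max ord0 by rewrite mulmx_cV2 a00 a01 mulNr.
  have u1E : u ord_max ord0 = - A ord_max ord0 * v ord0 ord0 +
      A ord0 ord0 * v ord_max ord0 by rewrite mulmx_cV2 a10 a11.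
  clearbody u; rewrite !mulmx_cV2 !mxE/= le_eqVlt; apply/orP; left; apply/eqP.
  by rewrite u0E u1E; ring.
rewrite rotE (le_trans (ler_wpM2r (enorm_ge0 _) (enorm_mulmx _ _)))// rotE.
by rewrite ler_piMr// mulr_ge0 ?opnorm_ge0 ?enorm_ge0.
Qed.

End operator_norm_theory.

Section SL2_theory.
Context {R : realType}.
Local Open Scope ring_scope.
Implicit Types a b : SL2 R.

Lemma det_SL2 a : \det (SL2mx a) = 1.
Proof. by case: a => M /= /eqP. Qed.

Lemma SL2_unitmx a : SL2mx a \in unitmx.
Proof. by rewrite unitmxE det_SL2 unitr1. Qed.

Lemma SL2mul_subproof a b : \det (SL2mx a *m SL2mx b) == 1.
Proof. by rewrite det_mulmx !det_SL2 mulr1. Qed.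

Definition SL2mul a b : SL2 R := mkSL2 (SL2mul_subproof a b).

Lemma SL2mulA : associative SL2mul.
Proof. by move=> a b c; apply: val_inj; exact: mulmxA. Qed.

Lemma SL2mul1 : left_id (SL2one R) SL2mul.
Proof. by move=> a; apply: val_inj; exact: mul1mx. Qed.

Lemma SL2mulr1 : right_id (SL2one R) SL2mul.
Proof. by move=> a; apply: val_inj; exact: mulmx1. Qed.

Lemma opnorm_invmx_le a : opnorm (invmx (SL2mx a)) <= opnorm (SL2mx a).
Proof.
have -> : invmx (SL2mx a) = \adj (SL2mx a).
  by rewrite /invmx SL2_unitmx det_SL2 invr1 scale1r.
exact: opnorm_adj.
Qed.

Lemma SL2inv_subproof a : \det (invmx (SL2mx a)) == 1.
Proof. by rewrite det_inv det_SL2 invr1. Qed.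

Definition SL2inv a : SL2 R := mkSL2 (SL2inv_subproof a).

Lemma opnorm_invmx a : opnorm (invmx (SL2mx a)) = opnorm (SL2mx a).
Proof.
apply/eqP; rewrite eq_le opnorm_invmx_le/=.
by rewrite -[X in opnorm X <= _]invmxK; exact: (opnorm_invmx_le (SL2inv a)).
Qed.

Lemma opnorm_SL2_ge1 a : 1 <= opnorm (SL2mx a).
Proof.
have := opnormM (SL2mx a) (invmx (SL2mx a)).
rewrite mulmxV ?SL2_unitmx// opnorm1 opnorm_invmx -expr2.
by rewrite -[X in X <= _ -> _](expr1n _ 2) ler_pXn2r// nnegrE ?opnorm_ge0.
Qed.

Lemma opnorm_SL2_gt0 a : 0 < opnorm (SL2mx a).
Proof. exact: lt_le_trans (opnorm_SL2_ge1 a). Qed.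

Definition lognorm a : R := ln (opnorm (SL2mx a)).

Lemma lognorm_ge0 a : 0 <= lognorm a.
Proof. by rewrite ln_ge0// opnorm_SL2_ge1. Qed.

Lemma lognorm1 : lognorm (SL2one R) = 0.
Proof. by rewrite /lognorm opnorm1 ln1. Qed.

Lemma lognorm_mul a b : lognorm (SL2mul a b) <= lognorm a + lognorm b.
Proof.
rewrite -lnM ?posrE ?opnorm_SL2_gt0// ler_ln ?posrE ?opnorm_SL2_gt0//.
  exact: opnormM.
by rewrite mulr_gt0// opnorm_SL2_gt0.
Qed.

Lemma lognorm_inv a : lognorm (SL2inv a) = lognorm a.
Proof. by rewrite /lognorm /= opnorm_invmx. Qed.

Lemma lognorm_mull a b : lognorm a <= lognorm (SL2mul a b) + lognorm b.
Proof.
rewrite -(lognorm_inv b); apply: le_trans (lognorm_mul _ _).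
suff -> : SL2mul (SL2mul a b) (SL2inv b) = a by [].
by apply: val_inj; rewrite /= mulmxK// SL2_unitmx.
Qed.

Lemma lognorm_mulr a b : lognorm b <= lognorm (SL2mul a b) + lognorm a.
Proof.
rewrite -(lognorm_inv a) addrC; apply: le_trans (lognorm_mul _ _).
suff -> : SL2mul (SL2inv a) (SL2mul a b) = b by [].
by apply: val_inj; rewrite /= mulKmx// SL2_unitmx.
Qed.

Lemma mdist_SL2E a b : mdist a b = opnorm (SL2mx a - SL2mx b).
Proof. by []. Qed.

(** As [opnorm b >= 1], the quotient of the norms is at most [1 + mdist a b], and
    [ln (1 + x) <= x]. *)
Lemma lognorm_lipschitz a b : lognorm a <= lognorm b + mdist a b.
Proof.
have b0 := opnorm_SL2_gt0 b; have a0 := opnorm_SL2_gt0 a.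
rewrite addrC -lerBlDr -lnV ?posrE// -lnM ?posrE ?invr_gt0//.
have h : opnorm (SL2mx a) / opnorm (SL2mx b) <= 1 + mdist a b.
  rewrite ler_pdivrMr// mulrDl mul1r.
  apply: (@le_trans _ _ (opnorm (SL2mx b) + mdist a b)).
    by have := opnormD (SL2mx b) (SL2mx a - SL2mx b); rewrite addrC subrK.
  by rewrite lerD2l ler_peMr ?mdist_ge0// opnorm_SL2_ge1.
apply: (@le_trans _ _ (ln (1 + mdist a b))).
  rewrite ler_ln ?posrE ?divr_gt0//.
  by rewrite (lt_le_trans ltr01)// lerDl mdist_ge0.
by apply: le_ln1Dx; rewrite (lt_le_trans _ (mdist_ge0 _ _))// ltrN10.
Qed.

End SL2_theory.

(** * Borel measurability through matrix entries *)

Section SL2_measurability.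
Context {R : realType}.
Local Open Scope ring_scope.

(** A set open for the operator norm is the union of the countably many rational boxes that it
    contains, enumerated here by [unpickle]. *)
Lemma measurable_entrywise_preimage d (T : measurableType d) (M : T -> 'M[R]_2)
    (U : set 'M[R]_2) :
  (forall i j, measurable_fun [set: T] (fun t => M t i j)) ->
  (forall A, U A -> exists2 e, 0 < e & forall B, opnorm (A - B) < e -> U B) ->
  measurable (M @^-1` U).
Proof.
move=> mM oU.
pose bx (q : 'M[rat]_2) (k : nat) : set 'M[R]_2 :=
  [set B | forall i j, `|B i j - ratr (q i j)| < k.+1%:R^-1].
pose F n : set T :=
  if @unpickle ('M[rat]_2 * nat)%type n is Some qk
  then if `[< bx qk.1 qk.2 `<=` U >] then M @^-1` bx qk.1 qk.2 else set0
  else set0.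
have -> : M @^-1` U = \bigcup_n F n.
  apply/seteqP; split => t.
    move=> /oU[e e0 eU].
    (* Two points of a box differ by at most [2 / (k + 1)] in each of the four entries, and the sum
       of the entries bounds the norm. *)
    pose k := Num.truncn (8 / e).
    have ke : 8 * k.+1%:R^-1 < e.
      by rewrite ltr_pdivrMr ?ltr0n// mulrC -ltr_pdivrMr//; exact: truncnS_gt.
    have k0 : 0 < k.+1%:R^-1 :> R by rewrite invr_gt0 ltr0n.
    have qP i j : {q : rat | `|M t i j - ratr q| < k.+1%:R^-1}.
      apply: cid; have : M t i j - k.+1%:R^-1 < M t i j + k.+1%:R^-1.
        by rewrite ltrD2l gtrN.
      by move=> /rat_in_itvoo[q]; rewrite in_itv/= -ltr_distlC; exists q.
    pose q : 'M[rat]_2 := \matrix_(i, j) sval (qP i j).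
    have Mq : bx q k (M t) by move=> i j; rewrite mxE; exact: svalP (qP i j).
    exists (pickle (q, k)) => //; rewrite /F pickleK/=.
    case: asboolP => // nU; exfalso; apply: nU => B Bq; apply: eU.
    apply: le_lt_trans ke; apply: (le_trans (opnorm_le_sum _)).
    have Eij i j : `|(M t - B) i j| <= 2 * k.+1%:R^-1.
      have -> : (M t - B) i j =
          (M t i j - ratr (q i j)) + (ratr (q i j) - B i j).
        by rewrite [LHS]mxE [X in _ + X]mxE addrA subrK.
      rewrite mulr_natl mulr2n (le_trans (ler_normD _ _))// lerD//.
        exact/ltW/Mq.
      by rewrite distrC; exact/ltW/Bq.
    rewrite !big_ord_recl !big_ord0 !addr0.
    have := Eij ord0 ord0; have := Eij ord0 (lift ord0 ord0).
    have := Eij (lift ord0 ord0) ord0.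
    have := Eij (lift ord0 ord0) (lift ord0 ord0).
    by move: k.+1%:R^-1 => x; lra.
  move=> [n _]; rewrite /F; case: unpickle => // qk.
  by case: asboolP => // qkU /qkU.
apply: bigcupT_measurable => n; rewrite /F; case: unpickle => // -[q k].
case: asboolP => // _.
rewrite [X in measurable X](_ : _ = \bigcap_(i in [set: 'I_2])
    \bigcap_(j in [set: 'I_2])
    [set t | `|M t i j - ratr (q i j)| < k.+1%:R^-1]); last first.
  by apply/seteqP; split => [t Ht i _ j _|t Ht i j]; [exact: Ht|exact: (Ht i I j I)].
apply: fin_bigcap_measurable => // i _; apply: fin_bigcap_measurable => // j _.
apply: measurable_ltr_set => //; apply: measurableT_comp => //.
exact: measurable_funB.
Qed.

Lemma measurable_opnorm d (T : measurableType d) (M : T -> 'M[R]_2) :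
  (forall i j, measurable_fun [set: T] (fun t => M t i j)) ->
  measurable_fun [set: T] (fun t => opnorm (M t)).
Proof.
move=> mM.
apply: (measurability _ (RGenInftyO.measurableE R)).
move=> _ [_ [r ->] <-]; rewrite setTI.
rewrite [X in measurable X](_ : _ = M @^-1` [set A | opnorm A < r]).
  apply: measurable_entrywise_preimage => // A /= Ar.
  exists (r - opnorm A); first by rewrite subr_gt0.
  move=> B; rewrite -opnormN opprB ltrBrDr; apply: le_lt_trans.
  by have := opnormD (B - A) A; rewrite subrK.
by apply/seteqP; split => t /=; rewrite in_itv.
Qed.

Lemma measurable_SL2 d (T : measurableType d) (f : T -> SL2 R) :
  (forall i j, measurable_fun [set: T] (fun t => f t i j)) ->
  measurable_fun [set: T] f.
Proof.
move=> mf.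
apply: (@measurability _ _ _ _ setT f (@open (SL2 R))) => //.
move=> _ [U oU <-]; rewrite setTI.
(* A union of balls of the full matrix space centred in [U]: an open set whose trace on SL(2,R) is
   [U]. *)
pose U' := [set A : 'M[R]_2 | exists a e, [/\ forall b, mdist a b < e -> U b &
  opnorm (SL2mx a - A) < e]].
rewrite [X in measurable X](_ : _ = (fun t => SL2mx (f t)) @^-1` U').
  apply: measurable_entrywise_preimage => // A [a [e [ae aA]]].
  exists (e - opnorm (SL2mx a - A)); first by rewrite subr_gt0.
  move=> B AB; exists a, e; split => //.
  have -> : SL2mx a - B = SL2mx a - A + (A - B) by rewrite addrA subrK.
  by rewrite (le_lt_trans (opnormD _ _))// -ltrBrDl.
apply/seteqP; split => t /=.
  move=> Uf; have := oU; rewrite openE => /(_ _ Uf) /nbhs_ballP[e /= e0 eU].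
  exists (f t), e; split => [b fb|]; last by rewrite subrr opnorm0.
  by apply: eU; rewrite ballEmdist.
by move=> [a [e [aU ae]]]; exact: aU.
Qed.

Lemma measurable_entry i j : measurable_fun [set: SL2 R] (fun a => a i j).
Proof.
have nbhs_open (U : set (SL2 R)) : (forall a, U a -> nbhs a U) -> open U.
  by rewrite openE.
apply: (measurability _ (RGenInftyO.measurableE R)).
move=> _ [_ [r ->] <-]; rewrite setTI; apply: sub_sigma_algebra.
apply: nbhs_open => a /=; rewrite in_itv/= => ar.
apply/nbhs_ballP; exists (r - a i j) => /=; first by rewrite subr_gt0.
move=> b; rewrite ballEmdist/= mdist_SL2E in_itv/= => ab.
have := le_entry_opnorm (SL2mx a - SL2mx b) i j; rewrite !mxE ler_norml.
by move=> /andP[h1 h2]; move: ab h1 h2; lra.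
Qed.

Lemma measurable_SL2mul :
  measurable_fun [set: SL2 R * SL2 R] (fun z => SL2mul z.1 z.2).
Proof.
apply: measurable_SL2 => i j; rewrite /=.
under eq_fun do rewrite mxE.
apply: measurable_sum => k; apply: measurable_funM.
  exact: measurableT_comp (measurable_entry i k) measurable_fst.
exact: measurableT_comp (measurable_entry k j) measurable_snd.
Qed.

Lemma measurable_lognorm : measurable_fun [set: SL2 R] (@lognorm R).
Proof.
apply: measurableT_comp (@measurable_ln R) _.
by apply: measurable_opnorm => i j; exact: measurable_entry.
Qed.

Lemma measurable_mdist_pair :
  measurable_fun [set: SL2 R * SL2 R] (fun z => mdist z.1 z.2 : R).
Proof.
apply: measurable_opnorm => i j; under eq_fun do rewrite !mxE.
apply: measurable_funB.
  exact: measurableT_comp (measurable_entry i j) measurable_fst.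
exact: measurableT_comp (measurable_entry i j) measurable_snd.
Qed.

End SL2_measurability.

(** * Lyapunov exponents of Bernoulli measures *)

Section bernoulli_measures.
Context {R : realType}.
Implicit Types p : probability (SL2 R) R.

Lemma measurable_SL2Z d (T : measurableType d) (f : T -> SL2Z R) :
  (forall n, measurable_fun [set: T] (fun t => f t n)) ->
  measurable_fun [set: T] f.
Proof.
move=> mf; apply: (@measurability _ _ _ _ setT f (@cylinders R)) => //.
move=> _ [_ [n _ [E mE <-]] <-]; exact: mf.
Qed.

Lemma measurable_coordZ n : measurable_fun [set: SL2Z R] (fun x : SL2Z R => x n).
Proof.
move=> _ E mE; rewrite setTI; apply: sub_sigma_algebra.
by exists n => //; exists E.
Qed.

(** [pickle] embeds the integers into [nat], so p^Z is an image of the one-sided product. Indices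
    that code no element of [s] get [setT] and contribute a factor 1. *)
Lemma ex_bernoulli p : exists mu, is_bernoulli p mu.
Proof.
have [P iP] := ex_iid p.
pose phi (x : seqT (SL2 R)) : SL2Z R := fun n : int => x (pickle n).
have mphi : measurable_fun [set: seqT (SL2 R)] phi.
  by apply: measurable_SL2Z => n; exact: measurable_coord.
exists (pushp P mphi) => s E us mE.
pose N := (\max_(n <- s) pickle n).+1.
pose E' k := if @pickle_inv int k is Some n then
  if n \in s then E n else setT else setT.
have mE' k : measurable (E' k).
  by rewrite /E'; case: pickle_inv => // n; case: ifP.
have sN n : n \in s -> (pickle n < N)%N.
  by move=> ns; rewrite ltnS; exact: leq_bigmax_seq.
rewrite pushpE [X in P X](_ : _ = box N E'); last first.
  apply/seteqP; split => x /=.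
    move=> H k kN; rewrite /E'; case Ek: pickle_inv => [n|//].
    case: ifPn => // ns; have := H n ns; rewrite /phi.
    by have := @pickle_invK int k; rewrite Ek /= => ->.
  by move=> H n ns; have := H _ (sN n ns); rewrite /E' pickleK_inv ns.
rewrite [LHS]iP// -(big_mkord xpredT (fun k => p (E' k))).
rewrite (bigID (fun k => k \in map pickle s))/= [X in _ * X]big1 ?mule1; last first.
  move=> k ks; suff -> : E' k = setT by exact: probability_setT.
  rewrite /E'; case Ek: pickle_inv => [n|//]; case: ifPn => // ns.
  have := @pickle_invK int k; rewrite Ek /= => nk.
  by move: ks; rewrite -nk map_f.
rewrite -big_filter (perm_big (map pickle s)); last first.
  apply: uniq_perm; first by rewrite filter_uniq// iota_uniq.
    by rewrite map_inj_uniq//; exact: pcan_inj (@pickleK _).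
  move=> k; rewrite mem_filter mem_index_iota leq0n/=.
  by apply: andb_idr => /mapP[n ns ->]; exact: sN.
rewrite big_map; apply: eq_big_seq => n ns.
by rewrite /E' pickleK_inv ns.
Qed.

Lemma bernoulli_measureP p : is_bernoulli p (bernoulli_measure p).
Proof. exact: (getPex (ex_bernoulli p)). Qed.

Definition seq_of (c : nat -> int) (x : SL2Z R) : seqT (SL2 R) := fun k => x (c k).

Lemma measurable_seq_of c : measurable_fun [set: SL2Z R] (seq_of c).
Proof. by apply: measurable_seqT => n; exact: measurable_coordZ. Qed.

(** The left inverse [c'] turns a box of the sequence into constraints on integer coordinates. Used
    with [c] running through 0, 1, 2, ... for the future and through -1, -2, ... for the past. *)
Lemma iid_seq_of p mu c c' : is_bernoulli p mu -> cancel c c' ->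
  is_iid p (pushp mu (measurable_seq_of c)).
Proof.
move=> bmu cK N E mE; have := bmu (map c (iota 0 N)) (E \o c').
rewrite map_inj_uniq ?iota_uniq; last exact: can_inj cK.
rewrite big_map => /(_ isT (fun n => mE _)) bE.
transitivity (\prod_(k <- iota 0 N) p ((E \o c') (c k))).
  rewrite -bE pushpE; congr (mu _); apply/seteqP; split => x /= H n.
    by move=> /mapP[k]; rewrite mem_iota add0n => /= kN ->; rewrite cK; exact: H.
  by move=> nN; have := H (c n); rewrite cK; apply; rewrite map_f// mem_iota.
rewrite -(big_mkord xpredT (fun k => p (E k))) /index_iota subn0.
by apply: eq_bigr => k _; rewrite /= cK.
Qed.

Lemma ae_const d (T : measurableType d) (mu : probability T R) (Q : Prop) :
  {ae mu, forall x, Q} -> Q.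
Proof.
move=> [A [mA A0 QA]]; apply: contrapT => nQ.
have AT : A = setT by apply/seteqP; split => // x _; exact: QA.
by move: A0; rewrite AT probability_setT => /eqP; rewrite onee_eq0.
Qed.

(** Two events of full measure have a common point, so a.e. limits are unique and [get] must return
    the known one. *)
Lemma get_ae_cvg d (T : measurableType d) (mu : probability T R)
    (u : T -> nat -> R) (l : R) :
  {ae mu, forall x, u x n @[n --> \oo] --> l} ->
  get [set l : R | {ae mu, forall x, u x n @[n --> \oo] --> l}] = l.
Proof.
move=> ul; set A := [set _ | _]; have Al : A l by [].
have AgA : A (get A) by apply: getPex; exists l.
apply: (@ae_const _ _ mu); apply: filterS2 ul AgA => x.
by move=> h1 h2; rewrite -(cvg_lim _ h1)// -(cvg_lim _ h2).
Qed.

Definition SL2drift p := drift SL2mul (SL2one R) (@lognorm R) p.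

Lemma cocycleE (x : SL2Z R) n :
  cocycle x n = SL2mx (walk SL2mul (SL2one R) (seq_of Posz x) n).
Proof. by elim: n => //= n ->. Qed.

(** Inversion reverses products: [cocycleV x n] is the inverse of x_{-1} ... x_{-n}, in which new
    letters enter on the right, hence the opposite multiplication. *)
Lemma cocycleVE (x : SL2Z R) n : cocycleV x n =
  invmx (SL2mx (walk (fun a b => SL2mul b a) (SL2one R)
    (seq_of (fun k => (- k.+1%:Z)%R) x) n)).
Proof.
elim: n => [|n IH] /=; first by rewrite invmx1.
set a := SL2mx (x _); set b := SL2mx (walk _ _ _ _) in IH *.
have ua : a \in unitmx := SL2_unitmx _; have ub : b \in unitmx := SL2_unitmx _.
have uba : (b *m a) \in unitmx by rewrite unitmx_mul ub.
rewrite IH -[LHS]mulmx1 -(mulmxV uba) !mulmxA -(mulmxA (invmx a)) mulVmx//.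
by rewrite mulmx1 mulVmx// mul1mx.
Qed.

Lemma lyap_plusE p : log_integrable p -> lyap_plus p = SL2drift p.
Proof.
move=> pN; apply: get_ae_cvg.
have iP := iid_seq_of (bernoulli_measureP p)
  (fun k : nat => erefl : absz (Posz k) = k).
have := ae_cvg_walk SL2mulA SL2mul1 SL2mulr1 measurable_SL2mul
  measurable_lognorm lognorm1 lognorm_ge0 lognorm_mul lognorm_mull pN iP.
move=> /ae_pushp; apply: filterS => x.
by under eq_fun do rewrite /lognorm -cocycleE.
Qed.

Lemma lyap_minusE p : log_integrable p -> lyap_minus p = (- SL2drift p)%R.
Proof.
move=> pN; apply: get_ae_cvg.
have cK : cancel (fun k => (- k.+1%:Z)%R) (fun z => (absz z).-1).
  by move=> k; rewrite abszN.
have iP := iid_seq_of (bernoulli_measureP p) cK.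
have mflip : measurable_fun [set: SL2 R * SL2 R] (fun z => SL2mul z.2 z.1).
  exact: (measurable_op measurable_SL2mul measurable_snd measurable_fst).
have fA : associative (fun a b : SL2 R => SL2mul b a).
  by move=> a b c; rewrite SL2mulA.
have := @ae_cvg_walk _ _ _ (fun a b => SL2mul b a) (SL2one R) _ fA SL2mulr1
  SL2mul1 mflip measurable_lognorm lognorm1 lognorm_ge0 _ _ _ pN _ iP.
rewrite (drift_flip _ SL2mulA SL2mul1 SL2mulr1 measurable_SL2mul
  measurable_lognorm lognorm_ge0).
move=> H; have {H} /ae_pushp := H
  (fun a b => eq_ind_r (fun t => lognorm _ <= t)%R (lognorm_mul b a) (addrC _ _))
  (fun a b => lognorm_mulr b a).
apply: filterS => x /cvgN; apply: cvg_trans.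
under eq_fun do rewrite cocycleVE opnorm_invmx.
pose w n := walk (fun a b : SL2 R => SL2mul b a) (SL2one R)
  (seq_of (fun k => (- k.+1%:Z)%R) x) n.
suff -> : (fun n => n%:R^-1 * ln (opnorm (SL2mx (w n)))^-1)%R =
  (fun n => - (n%:R^-1 * lognorm (w n)))%R by [].
apply/funext => n.
by rewrite /= lnV ?posrE ?opnorm_SL2_gt0// mulrN.
Qed.

End bernoulli_measures.

(** * The Wasserstein topology *)

Section wasserstein_continuity.
Context {R : realType}.
Implicit Types p q : probability (SL2 R) R.

Local Notation transferS p := (transfer (@SL2mul R) p).
Local Notation F p n := (iter n (transferS p) (EFin \o @lognorm R)).

Lemma mdist_SL2mull (a b b' : SL2 R) :
  (mdist (SL2mul a b) (SL2mul a b') <= opnorm (SL2mx a) * mdist b b')%R.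
Proof. by rewrite !mdist_SL2E /= -mulmxBr opnormM. Qed.

Lemma mdist_SL2mulr (a a' b : SL2 R) :
  (mdist (SL2mul a b) (SL2mul a' b) <= mdist a a' * opnorm (SL2mx b))%R.
Proof. by rewrite !mdist_SL2E /= -mulmxBl opnormM. Qed.

Lemma opnorm_le_mdist (a b : SL2 R) :
  (opnorm (SL2mx b) <= opnorm (SL2mx a) + mdist a b)%R.
Proof.
by rewrite metric_sym mdist_SL2E; have := opnormD (SL2mx a) (SL2mx b - SL2mx a);
  rewrite addrC subrK.
Qed.

Lemma measurable_opnorm_SL2 :
  measurable_fun [set: SL2 R] (fun a => opnorm (SL2mx a)).
Proof. by apply: measurable_opnorm => i j; exact: measurable_entry. Qed.

Let EFin_lognorm_ge0 (b : SL2 R) : 0 <= (EFin \o @lognorm R) b.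
Proof. by rewrite lee_fin lognorm_ge0. Qed.

Let measurable_EFin_lognorm : measurable_fun [set: SL2 R] (EFin \o @lognorm R).
Proof. by apply/measurable_EFinP; exact: measurable_lognorm. Qed.

Lemma F_ge0 p n b : 0 <= F p n b.
Proof. exact: iter_transfer_ge0 EFin_lognorm_ge0 b. Qed.

Lemma measurable_F p n : measurable_fun [set: SL2 R] (F p n).
Proof. by apply: measurable_iter_transfer => //; exact: measurable_SL2mul. Qed.

Lemma measurable_F_mulr d (T : measurableType d) p n b (f : T -> SL2 R) :
  measurable_fun [set: T] f ->
  measurable_fun [set: T] (fun t => F p n (SL2mul (f t) b)).
Proof.
move=> mf; apply: (measurableT_comp (measurable_F p n)).
exact: (measurable_op measurable_SL2mul mf (measurable_cst b)).
Qed.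

Lemma ge0_integralDM d (T : measurableType d) (P : probability T R)
    (f : T -> \bar R) (g : T -> R) (k : R) : measurable_fun [set: T] f ->
  (forall t, 0 <= f t) -> measurable_fun [set: T] g ->
  (forall t, 0 <= g t)%R -> (0 <= k)%R ->
  \int[P]_t (f t + (k * g t)%:E) = \int[P]_t f t + k%:E * \int[P]_t (g t)%:E.
Proof.
move=> mf f0 mg g0 k0; rewrite ge0_integralD//.
- congr (_ + _); under eq_integral do rewrite EFinM.
  rewrite ge0_integralZl_EFin//; first by move=> t _; rewrite lee_fin.
  exact/measurable_EFinP.
- by move=> t _; rewrite lee_fin mulr_ge0.
- by apply/measurable_EFinP; exact: measurable_funM.
Qed.

(** Left multiplication by [a] expands distances by at most [opnorm a], so each application of the
    operator multiplies the Lipschitz constant by at most the mean norm. *)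
Lemma F_lipschitz p (M : R) n b b' : \int[p]_a (opnorm (SL2mx a))%:E <= M%:E ->
  (0 <= M)%R -> F p n b <= F p n b' + (M ^+ n * mdist b b')%:E.
Proof.
move=> pM M0; elim: n b b' => [|n IH] b b'.
  by rewrite /= expr0 mul1r lee_fin lognorm_lipschitz.
rewrite iterS {1}/transfer.
apply: (@le_trans _ _ (\int[p]_a (F p n (SL2mul a b') +
    (M ^+ n * mdist b b' * opnorm (SL2mx a))%:E))).
  apply: ge0_le_integral => //.
  - by move=> a _; exact: F_ge0.
  - exact: measurable_F_mulr.
  - apply: emeasurable_funD; first exact: measurable_F_mulr.
    by apply/measurable_EFinP/measurable_funM => //; exact: measurable_opnorm_SL2.
  - move=> a _; rewrite (le_trans (IH _ (SL2mul a b')))// leeD2l// lee_fin.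
    by rewrite -mulrA ler_wpM2l ?exprn_ge0// mulrC mdist_SL2mull.
rewrite ge0_integralDM//.
- rewrite leeD2l// exprSr -mulrA (mulrC M) mulrA [leRHS]EFinM lee_wpmul2l//.
  by rewrite lee_fin mulr_ge0 ?exprn_ge0 ?mdist_ge0.
- exact: measurable_F_mulr.
- by move=> a; exact: F_ge0.
- exact: measurable_opnorm_SL2.
- by move=> a; exact: opnorm_ge0.
- by rewrite mulr_ge0 ?exprn_ge0 ?mdist_ge0.
Qed.

Lemma integral_coupling1 p q pi (f : SL2 R -> \bar R) : couplings p q pi ->
  measurable_fun [set: SL2 R] f -> (forall a, 0 <= f a) ->
  \int[p]_a f a = \int[pi]_z f z.1.
Proof.
move=> cpi mf f0; rewrite -(ge0_integral_pushp pi measurable_fst mf f0).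
apply: eq_measure_integral => A mA _.
transitivity (pi (A `*` setT)); first exact: esym (cpi A mA).1.
transitivity (pi (fst @^-1` A)); last by [].
by congr (pi _); apply/seteqP; split => z //= [].
Qed.

Lemma integral_coupling2 p q pi (f : SL2 R -> \bar R) : couplings p q pi ->
  measurable_fun [set: SL2 R] f -> (forall a, 0 <= f a) ->
  \int[q]_a f a = \int[pi]_z f z.2.
Proof.
move=> cpi mf f0; rewrite -(ge0_integral_pushp pi measurable_snd mf f0).
apply: eq_measure_integral => A mA _.
transitivity (pi (setT `*` A)); first exact: esym (cpi A mA).2.
transitivity (pi (snd @^-1` A)); last by [].
by congr (pi _); apply/seteqP; split => z //= [].
Qed.

(** In the recursion of [F_coupling], [M ^ k] is the Lipschitz constant met when one more factor is
    exchanged, and [M + 1] bounds the mean norm under [q], against which the earlier error is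
    integrated. *)
Fixpoint coupling_const (M : R) n : R :=
  if n is k.+1 then (coupling_const M k * (M + 1) + M ^+ k)%R else 0%R.

Lemma coupling_const_ge0 M n : (0 <= M)%R -> (0 <= coupling_const M n)%R.
Proof.
move=> M0; elim: n => //= n IH.
by rewrite addr_ge0 ?exprn_ge0// mulr_ge0// addr_ge0.
Qed.

(** The difference of the iterates is L_q (L_q^n - L_p^n) + (L_q - L_p) L_p^n, applied to [lognorm].
    The weight [opnorm b] is carried along because it is submultiplicative, which lets the induction
    hypothesis be integrated. *)
Lemma F_coupling p q pi (M delta : R) n b : couplings p q pi ->
  \int[p]_a (opnorm (SL2mx a))%:E <= M%:E -> (0 <= M)%R ->
  \int[pi]_z (mdist z.1 z.2)%:E <= delta%:E -> (0 <= delta)%R -> (delta <= 1)%R ->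
  F q n b <= F p n b + (delta * coupling_const M n * opnorm (SL2mx b))%:E.
Proof.
move=> cpi pM M0 pid d0 d1.
have qM : \int[q]_a (opnorm (SL2mx a))%:E <= (M + 1)%:E.
  rewrite (integral_coupling2 cpi (f := fun a => (opnorm (SL2mx a))%:E)); last 2 first.
  - by apply/measurable_EFinP; exact: measurable_opnorm_SL2.
  - by move=> a; rewrite lee_fin opnorm_ge0.
  apply: (@le_trans _ _ (\int[pi]_z ((opnorm (SL2mx z.1))%:E +
    (1 * mdist z.1 z.2)%:E))).
    apply: ge0_le_integral => //.
    - by move=> z _; rewrite lee_fin opnorm_ge0.
    - apply/measurable_EFinP.
      exact: measurableT_comp measurable_opnorm_SL2 measurable_snd.
    - apply: emeasurable_funD; apply/measurable_EFinP.
        exact: measurableT_comp measurable_opnorm_SL2 measurable_fst.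
      by under eq_fun do rewrite mul1r; exact: measurable_mdist_pair.
    - by move=> z _; rewrite mul1r -EFinD lee_fin opnorm_le_mdist.
  rewrite ge0_integralDM//.
  - rewrite mul1e EFinD leeD//; last by rewrite (le_trans pid)// lee_fin.
    rewrite -(integral_coupling1 cpi (f := fun a => (opnorm (SL2mx a))%:E))//.
      by apply/measurable_EFinP; exact: measurable_opnorm_SL2.
    by move=> a; rewrite lee_fin opnorm_ge0.
  - apply/measurable_EFinP.
    exact: measurableT_comp measurable_opnorm_SL2 measurable_fst.
  - by move=> z; rewrite lee_fin opnorm_ge0.
  - exact: measurable_mdist_pair.
  - by move=> z; exact: mdist_ge0.
elim: n b => [|n IH] b; first by rewrite /= mulr0 mul0r adde0.
set C := coupling_const M n in IH.
have C0 : (0 <= C)%R by exact: coupling_const_ge0.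
rewrite iterS {1}/transfer.
apply: (@le_trans _ _ (\int[q]_a (F p n (SL2mul a b) +
    (delta * C * opnorm (SL2mx b) * opnorm (SL2mx a))%:E))).
  apply: ge0_le_integral => //.
  - by move=> a _; exact: F_ge0.
  - exact: measurable_F_mulr.
  - apply: emeasurable_funD; first exact: measurable_F_mulr.
    by apply/measurable_EFinP/measurable_funM => //; exact: measurable_opnorm_SL2.
  - move=> a _; rewrite (le_trans (IH _))// leeD2l// lee_fin -[leRHS]mulrA.
    by rewrite ler_wpM2l ?mulr_ge0// mulrC opnormM.
rewrite ge0_integralDM//; last 5 first.
- exact: measurable_F_mulr.
- by move=> a; exact: F_ge0.
- exact: measurable_opnorm_SL2.
- by move=> a; exact: opnorm_ge0.
- by rewrite !mulr_ge0// opnorm_ge0.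
have h1 : \int[q]_a F p n (SL2mul a b) <= F p n.+1 b +
    (M ^+ n * opnorm (SL2mx b) * delta)%:E.
  rewrite (integral_coupling2 cpi (f := fun a => F p n (SL2mul a b))); last 2 first.
  - exact: measurable_F_mulr.
  - by move=> a; exact: F_ge0.
  apply: (@le_trans _ _ (\int[pi]_z (F p n (SL2mul z.1 b) +
      (M ^+ n * opnorm (SL2mx b) * mdist z.1 z.2)%:E))).
    apply: ge0_le_integral => //.
    - by move=> z _; exact: F_ge0.
    - by apply: measurable_F_mulr; exact: measurable_snd.
    - apply: emeasurable_funD.
        by apply: measurable_F_mulr; exact: measurable_fst.
      by apply/measurable_EFinP/measurable_funM => //; exact: measurable_mdist_pair.
    - move=> z _; apply: (le_trans (F_lipschitz n _ (SL2mul z.1 b) pM M0)).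
      rewrite leeD2l// lee_fin -mulrA ler_wpM2l ?exprn_ge0// mulrC metric_sym.
      exact: mdist_SL2mulr.
  rewrite ge0_integralDM//.
  - rewrite -(integral_coupling1 cpi (f := fun a => F p n (SL2mul a b))).
    + by rewrite leeD2l// [leRHS]EFinM lee_wpmul2l// lee_fin mulr_ge0 ?exprn_ge0 ?opnorm_ge0.
    + exact: measurable_F_mulr.
    + by move=> a; exact: F_ge0.
  - by apply: measurable_F_mulr; exact: measurable_fst.
  - by move=> z; exact: F_ge0.
  - exact: measurable_mdist_pair.
  - by move=> z; exact: mdist_ge0.
  - by rewrite mulr_ge0 ?exprn_ge0 ?opnorm_ge0.
have h2 : (delta * C * opnorm (SL2mx b))%:E * \int[q]_a (opnorm (SL2mx a))%:E <=
    (delta * C * opnorm (SL2mx b) * (M + 1))%:E.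
  by rewrite [leRHS]EFinM lee_wpmul2l// lee_fin !mulr_ge0// opnorm_ge0.
apply: (le_trans (leeD h1 h2)); rewrite -addeA -EFinD leeD2l// lee_fin.
by rewrite /= -/C le_eqVlt; apply/orP; left; apply/eqP; ring.
Qed.

End wasserstein_continuity.

(** * Upper semicontinuity of the drift *)

Section drift_upper_semicontinuity.
Context {R : realType}.
Implicit Types p q : probability (SL2 R) R.

Lemma measurable_mdist_one :
  measurable_fun [set: SL2 R] (fun a => mdist a (SL2one R) : R).
Proof.
have := measurable_fun_pair (@measurable_id _ (SL2 R) setT)
  (measurable_cst (SL2one R)).
by move=> /(measurableT_comp measurable_mdist_pair).
Qed.

Lemma finite_first_moment_opnorm p : finite_first_moment p ->
  exists2 M : R, (0 <= M)%R & \int[p]_a (opnorm (SL2mx a))%:E <= M%:E.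
Proof.
move=> pm; set I := \int[p]_a (mdist a (SL2one R))%:E.
have fI : I \is a fin_num.
  by rewrite ge0_fin_numE//; apply: integral_ge0 => a _; rewrite lee_fin mdist_ge0.
have mmd := measurable_mdist_one.
exists (1 + fine I)%R.
  rewrite addr_ge0// fine_ge0//; apply: integral_ge0 => a _.
  by rewrite lee_fin mdist_ge0.
rewrite EFinD fineK//.
apply: (@le_trans _ _ (\int[p]_a (1 + (1 * mdist a (SL2one R))%:E))).
  apply: ge0_le_integral => //.
  - by move=> a _; rewrite lee_fin opnorm_ge0.
  - by apply/measurable_EFinP; exact: measurable_opnorm_SL2.
  - by apply: emeasurable_funD => //; apply/measurable_EFinP; exact: measurable_funM.
  - move=> a _; rewrite mul1r -EFinD lee_fin metric_sym.
    by have := opnorm_le_mdist (SL2one R) a; rewrite opnorm1.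
rewrite ge0_integralDM//; last by move=> a; exact: mdist_ge0.
by rewrite mul1e integral_cst_prob.
Qed.

Lemma finite_first_moment_log p : finite_first_moment p -> log_integrable p.
Proof.
apply: le_lt_trans; apply: ge0_le_integral => //.
- by move=> a _; rewrite lee_fin; exact: lognorm_ge0.
- by apply/measurable_EFinP; exact: measurable_lognorm.
- by apply/measurable_EFinP; exact: measurable_mdist_one.
- move=> a _; rewrite lee_fin.
  by have := lognorm_lipschitz a (SL2one R); rewrite lognorm1 add0r.
Qed.

Lemma SL2drift_le p n : log_integrable p -> (0 < n)%N ->
  (n%:R * SL2drift p)%:E <= mean (@SL2mul R) (SL2one R) (@lognorm R) p n.
Proof. by move=> lp n0; exact: (drift_le SL2mulr1 lognorm_ge0 lp n0). Qed.

Lemma SL2drift_W1_usc p (a : R) : finite_first_moment p -> (SL2drift p < a)%R ->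
  exists2 e : R, (0 < e)%R & forall q, finite_first_moment q ->
    W1 p q < e%:E -> (SL2drift q < a)%R.
Proof.
move=> fp pa; have [M M0 pM] := finite_first_moment_opnorm fp.
have lp := finite_first_moment_log fp.
have eps0 : (0 < (a - SL2drift p) / 2)%R by rewrite divr_gt0// subr_gt0.
have [m [m0 hm]] := drift_approx SL2mulr1 lognorm_ge0 lp eps0.
set eps := ((a - SL2drift p) / 2)%R in eps0 hm.
have mR : (0 < m%:R :> R)%R by rewrite ltr0n.
have C0 := coupling_const_ge0 m M0; set C := coupling_const M m in C0.
have C1 : (0 < C + 1)%R by rewrite ltr_wpDl.
(* The bound 1 is the restriction on the cost in [F_coupling]. Dividing by [C + 1] instead of [C]
   keeps the denominator positive and makes [e * C < m * eps] strict. *)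
pose e := Num.min 1%R (m%:R * eps / (C + 1))%R.
have e0 : (0 < e)%R by rewrite lt_min ltr01 divr_gt0// mulr_gt0.
exists e => // q fq /ereal_inf_lt[_ [pi cpi <-] pie].
have := F_coupling m (SL2one R) cpi pM M0 (ltW pie) (ltW e0).
rewrite opnorm1 mulr1 -/C => /(_ _) H.
have {}H : mean (@SL2mul R) (SL2one R) (@lognorm R) q m <=
    mean (@SL2mul R) (SL2one R) (@lognorm R) p m + (e * C)%:E.
  by apply: H; rewrite ge_min lexx.
have := le_trans (SL2drift_le (finite_first_moment_log fq) m0) H.
move=> /le_trans/(_ (leeD hm (lexx _))); rewrite -EFinD lee_fin => h.
have eC : (e * C < m%:R * eps)%R.
  apply: (@lt_le_trans _ _ (e * (C + 1))%R); first by rewrite ltr_pM2l// ltrDl.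
  by rewrite -ler_pdivlMr// ge_min lexx orbT.
rewrite -(ltr_pM2l mR) (le_lt_trans h)//.
rewrite -/(SL2drift p) (_ : a = SL2drift p + eps + eps)%R; last first.
  by rewrite /eps; lra.
by rewrite [ltRHS]mulrDr ltrD2l.
Qed.

Local Notation dr p := (SL2drift (sval p)).

Lemma open_SL2drift_lt (a : R) :
  W1_open [set p : wasserstein_space R | (dr p < a)%R].
Proof.
move=> [p /set_mem fp] /= pa; have [e e0 H] := SL2drift_W1_usc fp pa.
by exists e => // -[q /set_mem fq] /= pq; exact: H.
Qed.

Lemma lyap_plus_usc : upper_semicontinuous
  (fun p : wasserstein_space R => (lyap_plus (sval p))%:E).
Proof.
have E (p : wasserstein_space R) : lyap_plus (sval p) = dr p.
  by case: p => p /= /set_mem fp; apply/lyap_plusE/finite_first_moment_log.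
move=> p a; rewrite E lte_fin => pa.
exists [set p | (dr p < a)%R]; last by move=> q; rewrite E lte_fin.
by exists [set p | (dr p < a)%R]; split => //; exact: open_SL2drift_lt.
Qed.

Lemma lyap_minus_lsc : lower_semicontinuous
  (fun p : wasserstein_space R => (lyap_minus (sval p))%:E).
Proof.
have E (p : wasserstein_space R) : lyap_minus (sval p) = (- dr p)%R.
  by case: p => p /= /set_mem fp; apply/lyap_minusE/finite_first_moment_log.
move=> p a; rewrite E lte_fin ltrNr => pa.
exists [set p | (dr p < - a)%R]; last by move=> q; rewrite E lte_fin ltrNr.
by exists [set p | (dr p < - a)%R]; split => //; exact: open_SL2drift_lt.
Qed.

End drift_upper_semicontinuity.

(** * The weak* topology *)

Section hyperbolic_mixtures.
Context {R : realType}.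

Let hyp_row (t : R) : 'rV[R]_2 :=
  \row_j (if j == ord0 then expR t else expR (- t))%R.

Lemma det_hyp t : \det (diag_mx (hyp_row t)) == 1%R.
Proof.
rewrite det_diag big_ord_recl big_ord1 !mxE/= -expRD subrr expR0//.
Qed.

Definition hyp (t : R) : SL2 R := mkSL2 (det_hyp t).

Lemma hyp0 : hyp 0 = SL2one R.
Proof.
apply: val_inj; rewrite /= -diag_const_mx; congr diag_mx.
by apply/rowP => j; rewrite !mxE oppr0 expR0 if_same.
Qed.

Lemma hypD s t : SL2mul (hyp s) (hyp t) = hyp (s + t)%R.
Proof.
apply: val_inj; rewrite /= mulmx_diag; congr diag_mx; apply/rowP => j.
by rewrite !mxE; case: ifP => _; rewrite -expRD// opprD.
Qed.

Lemma lognorm_hyp t : (0 <= t)%R -> lognorm (hyp t) = t.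
Proof.
move=> t0; rewrite /lognorm -[RHS]expRK; congr ln.
have tt : (expR (- t) <= expR t :> R)%R by rewrite ler_expR; lra.
apply/eqP; rewrite eq_le; apply/andP; split.
  apply: opnorm_le => v v1; apply: (@le_trans _ _ (expR t * enorm v)%R).
    rewrite -(ler_pXn2r (ltn0Sn 1)) ?nnegrE ?mulr_ge0 ?enorm_ge0 ?expR_ge0//.
    rewrite exprMn !enorm_sqr !mulmx_cV2 !mxE/= !mulr1n !mulr0n !mul0r addr0 add0r.
    rewrite mulrDr !exprMn lerD2l ler_wpM2r ?sqr_ge0//.
    by rewrite ler_pXn2r ?nnegrE ?expR_ge0.
  by rewrite ler_piMr ?expR_ge0.
have := le_entry_opnorm (SL2mx (hyp t)) ord0 ord0.
by rewrite !mxE/= mulr1n ger0_norm ?expR_ge0.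
Qed.

Let pick (s : R) (b : bool) : SL2 R := if b then hyp s else SL2one R.

Let measurable_pick s : measurable_fun [set: bool] (pick s).
Proof. by []. Qed.

Definition hyp_mix (tau s : R) : probability (SL2 R) R :=
  pushp (bernoulli_prob tau : probability bool R) (measurable_pick s).

Lemma integral_hyp_mix tau s (f : SL2 R -> \bar R) : (0 <= tau <= 1)%R ->
  measurable_fun [set: SL2 R] f -> (forall a, 0 <= f a) ->
  \int[hyp_mix tau s]_a f a =
  tau%:E * f (hyp s) + (1 - tau)%:E * f (SL2one R).
Proof.
move=> t01 mf f0; rewrite ge0_integral_pushp//.
by rewrite (integral_bernoulli_prob t01 (f := fun b => f (pick s b))).
Qed.

Lemma Rintegral_hyp_mix tau s (f : SL2 R -> R) : (0 <= tau <= 1)%R ->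
  measurable_fun [set: SL2 R] f ->
  (\int[hyp_mix tau s]_a f a = tau * f (hyp s) + (1 - tau) * f (SL2one R))%R.
Proof.
move=> t01 mf; rewrite /Rintegral integralE.
have mEf : measurable_fun [set: SL2 R] (EFin \o f) by exact/measurable_EFinP.
rewrite !integral_hyp_mix//; last 2 first.
- exact: measurable_funeneg.
- exact: measurable_funepos.
rewrite !funeposE !funenegE -!EFinN -!EFin_max -!EFinM -!EFinD /=.
set a := f (hyp s); set b := f (SL2one R).
have E (c : R) : (Num.max c 0 - Num.max (- c) 0 = c)%R.
  by case: (leP c 0%R) => c0; case: (leP (- c) 0)%R => c1; lra.
by rewrite -[in RHS](E a) -[in RHS](E b); ring.
Qed.

Lemma log_integrable_hyp_mix tau s : (0 <= tau <= 1)%R ->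
  log_integrable (hyp_mix tau s).
Proof.
move=> t01; rewrite /log_integrable/=.
rewrite (integral_hyp_mix s t01 (f := EFin \o @lognorm R)).
- by rewrite -!EFinM -EFinD ltry.
- by apply/measurable_EFinP; exact: measurable_lognorm.
- by move=> a; rewrite lee_fin lognorm_ge0.
Qed.

(** On [hyp t] with [t >= 0] the function [lognorm] is additive, so each step of the operator adds
    exactly [tau * s] and all terms of the infimum are equal. *)
Lemma SL2drift_hyp_mix tau s : (0 <= tau <= 1)%R -> (0 <= s)%R ->
  SL2drift (hyp_mix tau s) = (tau * s)%R.
Proof.
move=> t01 s0.
have F n t : (0 <= t)%R ->
    iter n (transfer (@SL2mul R) (hyp_mix tau s)) (EFin \o @lognorm R) (hyp t) =
    (t + n%:R * (tau * s))%:E.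
  elim: n t => [|n IH] t t0; first by rewrite /= mul0r addr0 lognorm_hyp.
  rewrite iterS {1}/transfer.
  rewrite (integral_hyp_mix s t01 (f := fun a => iter n
    (transfer (@SL2mul R) (hyp_mix tau s)) (EFin \o @lognorm R)
    (SL2mul a (hyp t)))).
  - rewrite hypD SL2mul1 !IH ?addr_ge0// -!EFinM -EFinD; congr EFin.
    by rewrite -natr1; ring.
  - exact: measurable_F_mulr.
  - by move=> a; exact: F_ge0.
have Em n : mean (@SL2mul R) (SL2one R) (@lognorm R) (hyp_mix tau s) n =
    (n%:R * (tau * s))%:E.
  by rewrite /mean -hyp0 F// add0r.
rewrite /SL2drift /drift (_ : [set _ | _ in _] = [set (tau * s)%:E]).
  by rewrite ereal_inf1.
apply/seteqP; split => [_ [n n0 <-]|_ ->].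
  by rewrite Em -EFinM mulKf// pnatr_eq0 -lt0n.
by exists 1%N => //; rewrite Em -EFinM mulKf.
Qed.

End hyperbolic_mixtures.

(** * Escape of mass in the weak* topology *)

Section weak_star.
Context {R : realType}.

Lemma cvg_initial_topology (S : choiceType) (T : topologicalType) (f : S -> T)
    (F : set_system S) (s : S) : Filter F ->
  f x @[x --> F] --> f s -> F --> (s : initial_topology f).
Proof.
move=> FF fF A /= [_ [[B oB <-] Bs BA]].
by apply: filterS BA _; apply: fF; exact: open_nbhs_nbhs.
Qed.

Lemma cvg_weak_star (u : nat -> weak_star_space R) (p : weak_star_space R) :
  (forall phi, @bounded_continuous R phi ->
    (\int[sval (u k)]_a phi a)%R @[k --> \oo] --> (\int[sval p]_a phi a)%R) ->
  u k @[k --> \oo] --> p.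
Proof.
move=> H; apply: cvg_initial_topology; apply/cvg_sup => -[phi bphi].
(* The product topology is itself a supremum of initial topologies, hence the second use of the
   lemma. *)
apply: cvg_initial_topology; exact: (H phi (set_mem bphi)).
Qed.

Let mixw (tau s : R) (t01 : (0 <= tau <= 1)%R) : weak_star_space R :=
  exist _ (hyp_mix tau s) (mem_set (log_integrable_hyp_mix s t01)).

Let t01 (k : nat) : (0 <= (k.+1%:R^-1 : R) <= 1)%R.
Proof. by rewrite invr_ge0 ler0n/= invf_le1 ?ler1n. Qed.

Let z01 : (0 <= (0 : R) <= 1)%R. Proof. by rewrite lexx ler01. Qed.

(* Mass [1/(k+1)] escapes along hyperbolic matrices of norm [e^(k+1)], which
   keeps the exponent equal to [1]. *)
Let escaping k := mixw k.+1%:R (t01 k).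

(** The Dirac mass at the identity, written as a mixture so that the same formulas give its
    integrals and its exponent. *)
Let limit := mixw 0%R z01.

Let escaping_cvg : escaping k @[k --> \oo] --> limit.
Proof.
apply: cvg_weak_star => phi [cphi [M phiM]].
have mphi : measurable_fun [set: SL2 R] phi.
  apply: (measurability _ (RGenOpens.measurableE R)).
  move=> _ [_ [a [b ->]] <-]; rewrite setTI; apply: sub_sigma_algebra.
  by apply: open_comp => [x _|]; [exact: cphi|exact: interval_open].
under eq_fun do rewrite Rintegral_hyp_mix//.
rewrite Rintegral_hyp_mix// mul0r add0r subr0 mul1r.
have M0 : (0 <= M)%R by apply: le_trans (phiM (SL2one R)); exact: normr_ge0.
apply/cvgrPdist_le => e e0; near=> k.
set t := (k.+1%:R^-1)%R; set a := phi _; set b := phi _.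
have -> : (a - (t * b + (1 - t) * a) = t * (a - b))%R by ring.
have tk : (t * (M + M) <= e)%R.
  rewrite /t mulrC ler_pdivrMr ?ltr0n// -ler_pdivrMl//.
  near: k; exists (Num.truncn (e^-1 * (M + M))) => // k /= Mk.
  by rewrite (le_trans (ltW (truncnS_gt _)))// ler_nat ltnS.
have t0 : (0 <= t)%R by rewrite invr_ge0 ler0n.
rewrite normrM ger0_norm// (le_trans _ tk)// ler_wpM2l//.
by rewrite (le_trans (ler_normB _ _))// lerD ?phiM.
Unshelve. all: by end_near. Qed.

Lemma lyap_plus_not_usc : ~ upper_semicontinuous
  (fun p : weak_star_space R => (lyap_plus (sval p))%:E).
Proof.
(* The threshold 1/2 separates the exponent 0 of [limit] from the exponent 1 of every
   [escaping k]. *)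
move=> usc; have [|V limV HV] := usc limit (2^-1)%R.
  rewrite lyap_plusE ?SL2drift_hyp_mix//; last exact: log_integrable_hyp_mix.
  by rewrite mul0r lte_fin invr_gt0.
have [k _ /(_ k (leqnn k)) /= Vk] := escaping_cvg limV.
have := HV _ Vk; rewrite lyap_plusE; last exact: log_integrable_hyp_mix.
rewrite SL2drift_hyp_mix// mulVf ?pnatr_eq0// lte_fin; lra.
Qed.

Lemma lyap_minus_not_lsc : ~ lower_semicontinuous
  (fun p : weak_star_space R => (lyap_minus (sval p))%:E).
Proof.
move=> lsc; have [|V limV HV] := lsc limit (- 2^-1)%R.
  rewrite lyap_minusE ?SL2drift_hyp_mix//; last exact: log_integrable_hyp_mix.
  by rewrite mul0r lte_fin ltrN2 invr_gt0.
have [k _ /(_ k (leqnn k)) /= Vk] := escaping_cvg limV.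
have := HV _ Vk; rewrite lyap_minusE; last exact: log_integrable_hyp_mix.
rewrite SL2drift_hyp_mix// mulVf ?pnatr_eq0// lte_fin; lra.
Qed.

End weak_star.

Theorem theorem1p1 (R : realType) :
  (upper_semicontinuous
     (fun p : wasserstein_space R => (lyap_plus (sval p))%:E) /\
   ~ upper_semicontinuous
     (fun p : weak_star_space R => (lyap_plus (sval p))%:E)) /\
  (lower_semicontinuous
     (fun p : wasserstein_space R => (lyap_minus (sval p))%:E) /\
   ~ lower_semicontinuous
     (fun p : weak_star_space R => (lyap_minus (sval p))%:E)).
Proof.
split; split.
- exact: lyap_plus_usc.
- exact: lyap_plus_not_usc.
- exact: lyap_minus_lsc.
- exact: lyap_minus_not_lsc.
Qed.
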